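(* Let $w:\mathbb{N}\to\mathbb{Z}_{\ge 0}$ be an additive arithmetic function (i.e. $w(mn)=w(m)+w(n)$ whenever $\gcd(m,n)=1$) with non-negative integer values such that $w(q)=1$ for every prime $q$. Let $E$ be the set of natural numbers that are not of the form $n+w(n)$ with $n\in\mathbb{N}$, and for $N\ge 1$ let $\Xi(N)=|[1,N]\cap E|$. Then \[ \Xi(N)\gg \frac{N}{\log\log N}, \] i.e. there is a constant $c>0$ such that $\Xi(N)\ge cN/\log\log N$ for all sufficiently large $N$.
   Context: Examples of admissible $w$ include $\omega(n)$ (number of distinct prime factors) and $\Omega(n)$ (number of prime factors counted with multiplicity). *)

(* Defs.v *)
From HB Require Import structures.
From mathcomp Require Import all_boot all_order all_algebra finmap.
From mathcomp Require Import all_classical all_reals all_analysis.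
Set Implicit Arguments.
Unset Strict Implicit.
Unset Printing Implicit Defensive.
Import Order.TTheory GRing.Theory Num.Theory.
Local Open Scope classical_set_scope.

(* Arithmetic functions have the positive integers as domain; the value at 0
   of a function on [nat] is never constrained nor used. *)
Definition additive_arith (w : nat -> nat) : Prop :=
  forall m n : nat, (0 < m)%N -> (0 < n)%N -> coprime m n ->
    w (m * n)%N = (w m + w n)%N.

Definition exceptional (w : nat -> nat) : set nat :=
  [set m | (0 < m)%N /\ ~ (exists2 n : nat, (0 < n)%N & m = (n + w n)%N)].

Definition Xi (w : nat -> nat) (N : nat) : nat :=
  #|` fset_set ([set m : nat | (1 <= m <= N)%N] `&` exceptional w)|%fset.

(* Main.v *)
(** Put [z = e(a/q)] with [q] a prime of size about [sqrt (ln (ln N))] and [a] a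
    large constant.  If [n + w n] missed few integers up to [N], the exponential
    sum [S] of [z ^ (n + w n)] over [n <= N] would be nearly the geometric sum of
    the [z ^ m]; precisely [|S| <= q + 2 Xi(N)].

    On the other hand [|S| >= N / q^2].  Write [f n = z ^ w n] and let [f'] be [f]
    with the [q]-part of [n] ignored.  The multiplicative function [f'] is
    [1 * h] with [h(p) = z - 1 = O(1/q)], so that [sum |h(d)|] over [d <= N] saves
    any fixed power of [q]; since [z ^ d <> 1] whenever [h d <> 0], the sum of
    [f' n * z ^ n] is at most [q * sum |h(d)|] and is negligible.  What is left are
    the [n] divisible by [q], where [z ^ n = 1] and [f n - f' n = (z - 1) f(n / q)]
    apart from the [n] divisible by [q^2].  As [|z - 1|] is about [1 / sqrt (ln ln N)],
    Turan's inequality shows that [f] is nearly constant on squarefree numbers,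
    which have density above one half, so the sum of [f] up to [N / q] has size
    at least a constant times [N / q]. *)

Require Import Defs.
From HB Require Import structures.
From mathcomp Require Import all_boot all_order all_algebra.
From mathcomp Require Import all_classical all_reals all_analysis.
From mathcomp Require Import finmap complex zify ring lra.
Import Order.TTheory GRing.Theory Num.Theory.
Import numFieldNormedType.Exports.
Import ComplexField.Normc.
Local Open Scope classical_set_scope.
Local Open Scope ring_scope.

Set Implicit Arguments.
Unset Strict Implicit.
Unset Printing Implicit Defensive.

(** * Chebyshev bounds *)

Section ChebyshevBounds.
Local Open Scope nat_scope.

Lemma prime_dvd_fact p n : prime p -> (p %| n`!) = (p <= n).
Proof.
move=> pp; elim: n => [|n IH].
  by rewrite fact0 dvdn1 leqn0; case: p pp => [|[|]].
rewrite factS Euclid_dvdM// IH [RHS]leq_eqVlt ltnS.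
have [/dvdn_leq-/(_ isT) h|nd] := boolP (p %| n.+1).
  by rewrite /= -ltnS -leq_eqVlt h.
by have [e|] := eqVneq p n.+1; rewrite //= -e dvdnn in nd.
Qed.

Lemma prod_primes_recr a b : a <= b ->
  \prod_(a <= p < b.+1 | prime p) p =
  \prod_(a <= p < b | prime p) p * (if prime b then b else 1).
Proof. by move=> ab; rewrite big_mkcond/= big_nat_recr//= -big_mkcond. Qed.

Lemma prod_primes_dvd (a b K : nat) :
  (forall p, prime p -> a <= p < b -> p %| K) ->
  \prod_(a <= p < b | prime p) p %| K.
Proof.
elim: b => [|b IH] H; first by rewrite big_geq.
have [ab|ba] := leqP a b; last by rewrite big_geq ?dvd1n.
have IH' : \prod_(a <= p < b | prime p) p %| K.
  by apply: IH => p pp /andP[ap pb]; apply: H; rewrite // ap ltnW.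
rewrite prod_primes_recr//; case: ifP => [pb|_]; last by rewrite muln1.
rewrite Gauss_dvd ?IH' ?H ?ab ?leqnn// coprime_sym big_nat_cond.
elim/big_rec: _ => [|i x /andP[/andP[_ ib] pi] cx]; first exact: coprimen1.
by rewrite coprimeMr cx andbT prime_coprime// dvdn_prime2// gtn_eqF.
Qed.

(** The two middle coefficients of the expansion of [(1 + 1) ^ (2m + 1)] are equal, and together
    they are at most [2 * 4 ^ m]. *)
Lemma bin_2m1_le m : 'C(m.*2.+1, m) <= 4 ^ m.
Proof.
have e : 'C(m.*2.+1, m.+1) = 'C(m.*2.+1, m).
  by rewrite -bin_sub; [congr ('C(_, _)); lia|lia].
have : 'C(m.*2.+1, m.+1) + 'C(m.*2.+1, m) <= 2 ^ m.*2.+1.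
  have -> : 2 ^ m.*2.+1 = (1 + 1) ^ m.*2.+1 by [].
  have h1 : m.+1 < m.*2.+2 by lia.
  have h2 : m < m.*2.+2 by lia.
  rewrite expnDn (bigD1 (Ordinal h1))// (bigD1 (Ordinal h2))/=; last first.
    by rewrite -val_eqE/=; lia.
  by rewrite !exp1n !muln1 addnA leq_addr.
rewrite e addnn -mul2n expnS leq_mul2l/= -mul2n expnM.
by [].
Qed.

(** Erdős's argument by strong induction. An even number above 2 adds no prime; for odd [n = 2k + 1]
    the primes in [[k + 2, n]] all divide ['C(n, k)], which is at most [4 ^ k], and induction
    handles those up to [k + 1]. *)
Lemma primorial_le n : \prod_(1 <= p < n.+1 | prime p) p <= 4 ^ n.
Proof.
elim/ltn_ind: n => n IH.
case: n IH => [|[|[|n]]] IH; first by rewrite big_geq.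
- by rewrite big_mkcond/= big_nat1/=.
- by rewrite big_mkcond/= big_nat_recr//= big_nat1.
have [on|en] := boolP (odd n); last first.
  have [m em] : exists m, n.+3 = m.+1.*2.+1.
    by exists (n./2); rewrite -[LHS]addn3 -{1}(odd_double_half n) (negbTE en); lia.
  rewrite em (@big_cat_nat _ _ _ m.+3)/=; [|lia|lia].
  have h1 := IH m.+2 ltac:(lia).
  have h2 : \prod_(m.+3 <= p < m.+1.*2.+2 | prime p) p <= 4 ^ m.+1.
    apply: leq_trans (bin_2m1_le m.+1); apply: dvdn_leq; first by rewrite bin_gt0; lia.
    apply: prod_primes_dvd => p pp /andP[p1 p2].
    have : p %| (m.+1.*2.+1)`! by rewrite prime_dvd_fact//; lia.
    rewrite -(@bin_fact _ m.+1); last by lia.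
    have -> : m.+1.*2.+1 - m.+1 = m.+2 by lia.
    by rewrite Euclid_dvdM// Euclid_dvdM// !prime_dvd_fact// => /or3P[//|h|h]; exfalso; move: h p1; clear; lia.
  apply: leq_trans (leq_mul h1 h2) _; rewrite -expnD leq_pexp2l//; lia.
rewrite prod_primes_recr// ifF; last first.
  apply/negbTE/negP => /even_prime[|]; first by [].
  by rewrite /= on.
rewrite muln1; apply: leq_trans (IH n.+2 _) _; first by [].
by rewrite leq_pexp2l.
Qed.

(** * Bounds for the prime counting function and primes in short ranges of powers of 4 *)

Definition primepi n := \sum_(1 <= p < n.+1) (prime p : nat).

(** At least [primepi n - m] primes lie in [(m, n]]; each exceeds [m], and their product divides the
    primorial. *)
Lemma primepi_upper m n : m <= n -> m ^ (primepi n - m) <= 4 ^ n.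
Proof.
move=> mn; have [->|m0] := posnP m.
  by rewrite subn0; apply: (@leq_trans 1); [case: (primepi n) => [|k]; rewrite ?expn0 ?exp0n|rewrite expn_gt0].
apply: leq_trans (primorial_le n).
rewrite (@big_cat_nat _ _ _ m.+1)//= ?ltnS//.
have -> : primepi n - m = (\sum_(1 <= p < m.+1) prime p +
   \sum_(m.+1 <= p < n.+1) prime p) - m.
  by rewrite -big_cat_nat.
apply: (@leq_trans (m ^ \sum_(m.+1 <= p < n.+1) prime p)).
  rewrite leq_pexp2l// leq_subLR leq_add2r.
  apply: (@leq_trans (\sum_(1 <= p < m.+1) 1)); first by apply: leq_sum => i _; exact: leq_b1.
  by rewrite sum_nat_const_nat muln1 subn1.
rewrite expn_sum -[X in X <= _]mul1n leq_mul//.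
  by rewrite prodn_cond_gt0// => i /prime_gt0.
rewrite [leqRHS]big_mkcond/= big_nat_cond [leqRHS]big_nat_cond.
apply: leq_prod => i /andP[/andP[mi _] _]; case: (prime i) => //=.
by rewrite expn1 ltnW.
Qed.

(** By Legendre's formula the exponent of [p] is the sum over [k] of [2n %/ p ^ k - 2 (n %/ p ^ k)].
    Each term is 0 or 1, and it vanishes as soon as [p ^ k > 2n]. *)
Lemma pow_logn_bin2 p n : prime p -> 0 < n -> p ^ logn p 'C(n.*2, n) <= n.*2.
Proof.
move=> pp n0; have h : n <= n.*2 by lia.
have p1 := prime_gt1 pp.
suff H : logn p 'C(n.*2, n) <= trunc_log p n.*2.
  by apply: (@leq_trans (p ^ trunc_log p n.*2)); [rewrite leq_pexp2l// ltnW|apply: trunc_logP => //; lia].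
have e : logn p (n.*2)`! = logn p 'C(n.*2, n) + (logn p n`!).*2.
  rewrite -(bin_fact h) lognM ?bin_gt0 ?muln_gt0 ?fact_gt0// lognM ?fact_gt0//.
  by rewrite (_ : n.*2 - n = n) ?addnn//; lia.
have -> : logn p 'C(n.*2, n) = logn p (n.*2)`! - (logn p n`!).*2 by lia.
rewrite leq_subLR !logn_fact//.
have -> : \sum_(1 <= k < n.+1) n %/ p ^ k = \sum_(1 <= k < n.*2.+1) n %/ p ^ k.
  rewrite [RHS](@big_cat_nat _ _ _ n.+1)//= [X in _ = _ + X]big_nat_cond.
  rewrite [X in _ = _ + X]big1 ?addn0// => i /andP[/andP[ni _] _].
  rewrite divn_small//; apply: (leq_trans ni); apply: ltnW.
  exact: ltn_expl.
have -> : trunc_log p n.*2 = \sum_(1 <= k < n.*2.+1) (p ^ k <= n.*2).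
  rewrite (@big_cat_nat _ _ _ (trunc_log p n.*2).+1)//=; last first.
    rewrite ltnS; apply: ltnW; apply: leq_trans (ltn_expl _ p1) _.
    by apply: trunc_logP => //; lia.
  rewrite [X in _ = _ + X]big_nat_cond [X in _ = _ + X]big1 ?addn0; last first.
    move=> i /andP[/andP[hi _] _]; apply/eqP; rewrite eqb0 -ltnNge.
    by apply: (leq_trans (trunc_log_ltn _ p1)); rewrite leq_pexp2l// ltnW.
  rewrite big_nat_cond (eq_bigr (fun=> 1)); last first.
    move=> i /andP[/andP[_ hi] _]; apply/eqP; rewrite eqb1.
    apply: (@leq_trans (p ^ trunc_log p n.*2)); first by rewrite leq_pexp2l// ltnW.
    by apply: trunc_logP => //; lia.
  by rewrite -big_nat_cond sum_nat_const_nat muln1 subn1.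
rewrite -[(\sum_(1 <= k < _) n %/ p ^ k).*2]addnn -!big_split/=; apply: leq_sum => k _.
have pk : 0 < p ^ k by rewrite expn_gt0 ltnW.
have [hk|hk] := leqP (p ^ k) n.*2.
  rewrite -ltnS addn1 -(ltn_pmul2r pk); have := divn_eq n (p ^ k).
  have := leq_divM (n.*2) (p ^ k); have := ltn_pmod n pk; nia.
by rewrite divn_small.
Qed.

Lemma exp2_le_bin2 n : 2 ^ n <= 'C(n.*2, n).
Proof.
elim: n => // n IH.
have h1 := mul_bin_diag n.*2.+2 n; rewrite /= in h1.
have h2 := mul_bin_down n.*2.+1 n; rewrite /= in h2.
have e : n.*2.+1 - n = n.+1 by lia.
rewrite e in h2; rewrite expnS doubleS.
suff : n.+1 * (2 * 2 ^ n) <= n.+1 * 'C(n.*2.+2, n.+1) by rewrite leq_pmul2l.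
rewrite -h1 mulnCA; nia.
Qed.

(** The central binomial coefficient is at least [2 ^ n], yet it is a product of at most
    [primepi n.*2] prime powers, none above [2n]. *)
Lemma primepi_lower n : 0 < n -> 2 ^ n <= n.*2 ^ primepi n.*2.
Proof.
move=> n0; apply: leq_trans (exp2_le_bin2 n) _.
have b0 : 0 < 'C(n.*2, n) by rewrite bin_gt0; lia.
rewrite [X in X <= _]prod_prime_decomp// prime_decompE big_map/=.
apply: (@leq_trans (\prod_(p <- primes 'C(n.*2, n)) n.*2)).
  rewrite big_seq [leqRHS]big_seq; apply: leq_prod => p; rewrite mem_primes => /and3P[pp _ _].
  exact: pow_logn_bin2.
rewrite big_const_seq iter_muln muln1 count_predT leq_pexp2l//; first by lia.
rewrite /primepi -sum1_size.
have -> : \sum_(1 <= p < n.*2.+1) prime p = \sum_(p <- [seq p <- index_iota 1 n.*2.+1 | prime p]) 1.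
  by rewrite big_filter [RHS]big_mkcond/=; apply: eq_bigr => i _; case: (prime i).
rewrite !sum1_size; apply: uniq_leq_size; first exact: primes_uniq.
move=> p; rewrite mem_primes mem_filter mem_index_iota => /and3P[pp _ pd].
rewrite pp prime_gt0//= ltnS -prime_dvd_fact//.
by rewrite -(@bin_fact _ n) ?dvdn_mulr//; lia.
Qed.

(** Without such a prime, [primepi] would agree at both ends, and the upper bound at [4 ^ j] (used
    with cutoff [2 ^ j]) would contradict the lower bound at [4 ^ (j + 3)]. *)
Lemma prime_between j : 0 < j -> exists2 q, prime q & 4 ^ j < q <= 4 ^ (j + 3).
Proof.
move=> j0.
have e4 i : 4 ^ i = 2 ^ i * 2 ^ i by rewrite -expnMn.
have H1 : (primepi (4 ^ j) - 2 ^ j) * j <= 2 * 4 ^ j.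
  have := @primepi_upper (2 ^ j) (4 ^ j) _.
  rewrite -expnM {3}(_ : 4 = 2 ^ 2)// -expnM leq_exp2l// mulnC; apply.
  by rewrite e4 leq_pmull// expn_gt0.
have H2 : 4 ^ (j + 3) <= 4 * (j + 3) * primepi (4 ^ (j + 3)).
  have e : 4 ^ (j + 3) = (2 * 4 ^ (j + 2)).*2 by rewrite addnS expnS; lia.
  have := @primepi_lower (2 * 4 ^ (j + 2)) _; rewrite -e {3}(_ : 4 = 2 ^ 2)// -!expnM leq_exp2l//.
  have -> : 0 < 2 * 4 ^ (j + 2) by rewrite muln_gt0 expn_gt0.
  move=> /(_ isT); nia.
have H3 : j < 2 ^ j by exact: ltn_expl.
have [/hasP[q]|/hasPn H] := boolP (has (fun q => prime q) (index_iota (4 ^ j).+1 (4 ^ (j + 3)).+1)).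
  by rewrite mem_index_iota => /andP[h1 h2] pq; exists q; rewrite // h1.
exfalso.
have e : primepi (4 ^ (j + 3)) = primepi (4 ^ j).
  rewrite /primepi (@big_cat_nat _ _ _ (4 ^ j).+1)//= ?ltnS ?leq_pexp2l ?leq_addr//.
  rewrite [X in _ + X]big_seq [X in _ + X]big1 ?addn0// => i /H; by case: (prime i).
rewrite e addnC expnD in H2.
have H4 := e4 j; rewrite H4 in H1 H2.
(* With [t = 2 ^ j], the bounds read [P j <= 3 t^2] and [64 t^2 <= 4 (j + 3) P]; since
   [j + 3 <= 4 j], the latter is at most [48 t^2]. *)
move: (primepi _) H1 H2 H3 => P; move: (2 ^ j) => t H1 H2 H3.
have H5 : P * j <= 2 * (t * t) + t * j by nia.
have H6 : P * j <= 3 * (t * t) by nia.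
have : (3 + j) <= 4 * j by lia.
nia.
Qed.

End ChebyshevBounds.

(** * Sums over primes *)

Section ElementarySums.
Variable R : realType.
Implicit Types (n p k : nat).

Lemma le_of_eq (x y : R) : x = y -> x <= y.
Proof. by move->. Qed.

Lemma ln_inv_ge (x : R) : 0 < x -> 1 - x^-1 <= ln x.
Proof.
move=> x0; rewrite -[x in ln x]invrK lnV ?posrE ?invr_gt0//.
have := @le_ln1Dx R (x^-1 - 1); rewrite subrKC; have := invr_gt0 x; rewrite x0; lra.
Qed.

Lemma ln_subr1_le (x : R) : 0 < x -> ln x <= x - 1.
Proof. by move=> x0; have := @le_ln1Dx R (x - 1); rewrite subrKC; lra. Qed.

Lemma ln2_ge : 1 / 2 <= ln 2 :> R.
Proof. by have := @ln_inv_ge 2 ltac:(lra); lra. Qed.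

Lemma ln4_le : ln 4 <= 2 :> R.
Proof.
have -> : 4 = 2 ^+ 2 :> R by rewrite expr2; lra.
rewrite lnXn// mulr2n; have := @ln_subr1_le 2 ltac:(lra); lra.
Qed.

Lemma ln_natr_ge0 n : 0 <= ln n%:R :> R.
Proof.
by case: n => [|n]; [rewrite ln0|rewrite ln_ge0// ler1n].
Qed.

Lemma ler_ln_nat m n : (0 < m)%N -> (m <= n)%N -> ln m%:R <= ln n%:R :> R.
Proof.
by move=> m0 mn; rewrite ler_ln ?posrE ?ltr0n ?ler_nat// (leq_trans m0).
Qed.

Lemma ln_prod_nat (r : seq nat) (P : pred nat) (F : nat -> nat) :
  (forall i, P i -> (0 < F i)%N) ->
  ln (\prod_(i <- r | P i) F i)%N%:R = \sum_(i <- r | P i) ln (F i)%:R :> R.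
Proof.
move=> F0; elim: r => [|a r IH]; first by rewrite !big_nil ln1.
rewrite !big_cons; case: ifP => // Pa.
by rewrite natrM lnM ?posrE ?ltr0n ?IH ?F0// prodn_cond_gt0.
Qed.

Definition chebyshev_theta n : R := \sum_(1 <= p < n.+1 | prime p) ln p%:R.

Lemma chebyshev_theta_le n : chebyshev_theta n <= 2 * n%:R.
Proof.
rewrite /chebyshev_theta -(ln_prod_nat _ (F := id)); last by move=> i /prime_gt0.
apply: (@le_trans _ _ (ln (4 ^ n)%N%:R)).
  apply: ler_ln_nat (primorial_le n); rewrite prodn_cond_gt0// => i; exact: prime_gt0.
rewrite natrX lnXn// -[ln 4 *+ n]mulr_natr ler_wpM2r//; exact: ln4_le.
Qed.

Lemma harmonic_le n : (0 < n)%N -> \sum_(1 <= j < n.+1) j%:R^-1 <= 1 + ln n%:R :> R.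
Proof.
elim: n => // -[|n] IH _; first by rewrite big_nat1 ln1 invr1 addr0.
rewrite big_nat_recr//=; have := IH isT.
have h : (n.+2%:R : R)^-1 <= ln n.+2%:R - ln n.+1%:R.
  rewrite -ln_div ?posrE//; apply: le_trans (ln_inv_ge _); last by rewrite divr_gt0.
  rewrite invf_div -[n.+2%:R]natr1; have : (0 : R) < n.+1%:R by rewrite ltr0n.
  move: (n.+1%:R : R) => b b0.
  rewrite (_ : 1 - b / (b + 1) = (b + 1)^-1)//; field; lra.
move: h; move: (n.+2%:R^-1) (ln n.+2%:R) (ln n.+1%:R) => a b c; lra.
Qed.

Definition recip_primes n : R := \sum_(1 <= p < n.+1 | prime p) p%:R^-1.

Lemma recip_primes_ge0 n : 0 <= recip_primes n.
Proof. by apply: sumr_ge0 => i _. Qed.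

Lemma recip_primes_mono m n : (m <= n)%N -> recip_primes m <= recip_primes n.
Proof.
move=> mn; rewrite /recip_primes (@big_cat_nat _ _ _ m.+1 1 n.+1)//= lerDl.
by apply: sumr_ge0 => i _.
Qed.

(** On this block [ln p >= k ln 2 >= k / 2], so [1 / p] is at most [2 / (k 2^k)] times [ln p], and
    Chebyshev's bound sums the logarithms. *)
Lemma recip_primes_dyadic k : (0 < k)%N ->
  \sum_((2 ^ k).+1 <= p < (2 ^ k.+1).+1 | prime p) p%:R^-1 <= 8 / k%:R :> R.
Proof.
move=> k0.
have h1 : \sum_((2 ^ k).+1 <= p < (2 ^ k.+1).+1 | prime p) ln p%:R <= 2 * (2 ^ k.+1)%:R :> R.
  apply: le_trans (chebyshev_theta_le _).
  rewrite /chebyshev_theta (@big_cat_nat _ _ _ (2 ^ k).+1 1)//= ?ltnS ?leq_pexp2l//.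
  rewrite lerDr; apply: sumr_ge0 => i _; exact: ln_natr_ge0.
have k0' : (0 : R) < k%:R by rewrite ltr0n.
have t0 : (0 : R) < 2 ^+ k by rewrite exprn_gt0.
apply: (@le_trans _ _ (\sum_((2 ^ k).+1 <= p < (2 ^ k.+1).+1 | prime p)
    (2 / (k%:R * 2 ^+ k)) * ln p%:R)).
  rewrite big_nat_cond [leRHS]big_nat_cond; apply: ler_sum => p /andP[/andP[p1 _] _].
  have p0 : (0 : R) < p%:R by rewrite ltr0n; apply: leq_trans p1.
  have h2 : (2 ^+ k : R) <= p%:R by rewrite -natrX ler_nat ltnW.
  have h3 : k%:R / 2 <= ln p%:R :> R.
    apply: (@le_trans _ _ (ln (2 ^+ k))); last by rewrite ler_ln ?posrE.
    rewrite lnXn// -[ln 2 *+ k]mulr_natl ler_wpM2l//; have := ln2_ge; lra.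
  have h4 : (p%:R)^-1 <= (2 ^+ k)^-1 :> R by rewrite lef_pV2 ?posrE.
  apply: (le_trans h4); rewrite -[X in X <= _]mul1r.
  have -> : 2 / (k%:R * 2 ^+ k) * ln p%:R = (2 / k%:R * ln p%:R) * (2 ^+ k)^-1 :> R.
    by field; rewrite !gt_eqF.
  rewrite ler_wpM2r//.
  apply: (@le_trans _ _ (2 / k%:R * (k%:R / 2))); last by rewrite ler_wpM2l// divr_ge0// ltW.
  by apply: le_of_eq; field; rewrite gt_eqF.
rewrite -mulr_sumr; apply: le_trans (ler_wpM2l _ h1) _.
  by rewrite divr_ge0// mulr_ge0 ?ltW.
rewrite natrX exprS; apply: le_of_eq; field.
by rewrite !gt_eqF.
Qed.

Lemma recip_primes_pow2 k : (0 < k)%N -> recip_primes (2 ^ k) <= 9 + 8 * ln k%:R.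
Proof.
move=> k0; suff H : recip_primes (2 ^ k) <= 1 / 2 + \sum_(1 <= j < k) 8 / j%:R.
  apply: (le_trans H); rewrite -mulr_sumr.
  have : \sum_(1 <= j < k) j%:R^-1 <= \sum_(1 <= j < k.+1) j%:R^-1 :> R.
    by rewrite (@big_cat_nat _ _ _ k 1 k.+1)//= lerDl big_nat1 invr_ge0.
  have := harmonic_le k0; lra.
elim: k k0 => // -[_ _|k IH _].
  rewrite [in leRHS]big_geq// addr0 /recip_primes big_mkcond/= expn1.
  by rewrite big_nat_recr//= big_nat1/=; lra.
rewrite /recip_primes (@big_cat_nat _ _ _ (2 ^ k.+1).+1)//= ?ltnS ?leq_pexp2l//.
rewrite big_nat_recr//= addrA; apply: lerD; first exact: IH.
exact: recip_primes_dyadic.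
Qed.

(** The upper half of Mertens' theorem: the dyadic blocks give a harmonic sum in the exponent, whose
    logarithm is of order [ln (ln n)]. The summand 1 keeps the argument of the outer logarithm
    positive at [n = 1]. *)
Lemma recip_primes_le n : (0 < n)%N -> recip_primes n <= 9 + 8 * ln (1 + 2 * ln n%:R).
Proof.
move=> n0; have h1 := ltnW (trunc_log_ltn n (isT : 1 < 2)%N).
have h2 := trunc_logP (isT : 1 < 2)%N n0.
apply: le_trans (recip_primes_mono h1) _; apply: le_trans (recip_primes_pow2 _) _ => //.
rewrite lerD2l ler_pM2l//.
have h3 : (trunc_log 2 n)%:R * ln 2 <= ln n%:R :> R.
  by rewrite mulr_natl -lnXn// ler_ln ?posrE ?ltr0n ?exprn_gt0// -natrX ler_nat.
have h4 := ln2_ge.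
have h5 : (0 : R) <= (trunc_log 2 n)%:R by [].
rewrite ler_ln ?posrE//; last by have := ln_natr_ge0 n; lra.
rewrite -natr1; nra.
Qed.

Lemma sum_ln_div_sqr n : \sum_(2 <= a < n.+2) ln a%:R / a%:R ^+ 2 <= 2 :> R.
Proof.
(* The tail integral of [ln t / t^2] from [x] is [(ln x + 1) / x]; the constant 2 in place of 1
   leaves room for passing from integral to sum and makes the empty case exact. *)
suff H : \sum_(2 <= a < n.+2) ln a%:R / a%:R ^+ 2 <= 2 - (ln n.+1%:R + 2) / n.+1%:R :> R.
  apply: (le_trans H); rewrite gerBl divr_ge0// addr_ge0// ln_natr_ge0//.
elim: n => [|n IH]; first by rewrite big_geq// ln1; lra.
rewrite big_nat_recr//=; apply: le_trans (lerD IH (lexx _)) _.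
have b0 : (1 : R) <= n.+1%:R by rewrite ler1n.
have e : n.+2%:R = n.+1%:R + 1 :> R by rewrite natr1.
have hl : ln n.+2%:R - ln n.+1%:R <= n.+1%:R^-1 :> R.
  rewrite -ln_div ?posrE//; apply: le_trans (ln_subr1_le _) _; first by rewrite divr_gt0.
  by rewrite e mulrDl mulfV ?gt_eqF// ?ltr0n// mul1r addrAC subrr add0r.
rewrite e in hl *; move: (ln_natr_ge0 n.+2); rewrite e.
move: (ln (n.+1%:R + 1)) hl => l; move: (ln n.+1%:R) => l' hl l0.
move: (n.+1%:R : R) b0 hl => b b1 hl.
have b0 : 0 < b by lra.
rewrite -subr_ge0.
have -> : 2 - (l + 2) / (b + 1) - (2 - (l' + 2) / b + l / (b + 1) ^+ 2) =
  (l' + b^-1 - l) / b + l / (b * (b + 1) ^+ 2) + (b - 1) / (b ^+ 2 * (b + 1)).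
  by field; rewrite !gt_eqF//; lra.
rewrite !addr_ge0// divr_ge0//; try lra.
- by rewrite mulr_ge0// ?exprn_ge0//; lra.
- by rewrite mulr_ge0// ?exprn_ge0//; lra.
Qed.

Lemma sum_mul_expr_le (r : R) n : 0 <= r <= 1 / 2 ->
  \sum_(2 <= k < n.+2) k%:R * r ^+ k <= 6 * r ^+ 2.
Proof.
move=> /andP[r0 r1].
(* At [r = 1/2] the term [6 r^2] is the whole series and the subtracted term is its exact tail. *)
suff H : \sum_(2 <= k < n.+2) k%:R * r ^+ k <= 6 * r ^+ 2 - 2 * n.+3%:R * r ^+ n.+2.
  by apply: (le_trans H); rewrite gerBl mulr_ge0// exprn_ge0.
elim: n => [|n IH]; first by rewrite big_geq//; lra.
rewrite big_nat_recr//=; apply: le_trans (lerD IH (lexx _)) _.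
have h : 0 <= r ^+ n.+2 by exact: exprn_ge0.
rewrite [r ^+ n.+3]exprS -[n.+4%:R]natr1 -[n.+3%:R]natr1.
move: (n.+2%:R : R) (ler0n R n.+2) => t t0; move: (r ^+ n.+2) h => u u0.
have : 0 <= u * ((t + 2) * (1 - 2 * r)) by rewrite !mulr_ge0//; lra.
lra.
Qed.

End ElementarySums.

(** * Turan inequality and squarefree numbers *)

Section TuranKubilius.
Variable R : realType.
Implicit Types (n p d x : nat).

Lemma natr_divn_le n d : (n %/ d)%:R <= n%:R / d%:R :> R.
Proof.
have [->|d0] := posnP d; first by rewrite divn0 invr0 mulr0.
by rewrite ler_pdivlMr ?ltr0n// -natrM ler_nat leq_divM.
Qed.

Lemma natr_divn_ge n d : (0 < d)%N -> n%:R / d%:R - 1 <= (n %/ d)%:R :> R.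
Proof.
move=> d0; rewrite lerBlDr ler_pdivrMr ?ltr0n// natr1 -natrM ler_nat.
by rewrite ltnW// ltn_ceil.
Qed.

Lemma sum_dvdn_indic d x :
  \sum_(1 <= n < x.+1) (d %| n)%:R = (x %/ d)%:R :> R.
Proof. by rewrite divn_count_dvd natr_sum. Qed.

Lemma omega_sum n x : (0 < n <= x)%N ->
  (size (primes n))%:R = \sum_(1 <= p < x.+1 | prime p) (p %| n)%:R :> R.
Proof.
move=> /andP[n0 nx]; rewrite -sum1_size natr_sum/=.
have -> : primes n = [seq p <- index_iota 1 x.+1 | prime p && (p %| n)%N].
  apply: (irr_sorted_eq ltn_trans ltnn); first exact: sorted_primes.
    by rewrite sorted_filter ?iota_ltn_sorted//; exact: ltn_trans.
  move=> p; rewrite mem_primes mem_filter mem_index_iota n0/=.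
  apply/andP/andP => [[pp pn]|[/andP[-> ->]]//].
  by rewrite pp pn prime_gt0// ltnS (leq_trans _ nx)// dvdn_leq.
rewrite big_filter big_mkcondr/=; apply: eq_bigr => p _.
by case: (p %| n)%N.
Qed.

Lemma sum_delta_le (s : seq nat) (P : pred nat) p : uniq s ->
  \sum_(r <- s | P r) (r == p)%:R <= 1 :> R.
Proof.
move=> us; rewrite -natr_sum lern1 big_mkcond/=.
apply: (@leq_trans (\sum_(r <- s | r == p) 1)%N).
  by rewrite [leqRHS]big_mkcond/=; apply: leq_sum => i _; case: (P i); case: (i == p).
by rewrite sum1_count count_uniq_mem// leq_b1.
Qed.

(** Expand the square. The first moment is at least [x (mu - 1)]. In the second moment, distinct
    primes [p], [r] contribute at most [x / (p r)] and the diagonal at most [x mu], so the main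
    terms [x mu^2] cancel. *)
Lemma turan_kubilius x :
  \sum_(1 <= n < x.+1) ((size (primes n))%:R - recip_primes R x) ^+ 2
    <= 3 * x%:R * recip_primes R x.
Proof.
set mu := recip_primes R x; have mu0 : 0 <= mu := recip_primes_ge0 R x.
have -> : \sum_(1 <= n < x.+1) ((size (primes n))%:R - mu) ^+ 2 =
  \sum_(1 <= n < x.+1) (size (primes n))%:R ^+ 2
  - 2 * mu * \sum_(1 <= n < x.+1) (size (primes n))%:R + x%:R * mu ^+ 2.
  rewrite mulr_sumr -sumrB.
  have -> : x%:R * mu ^+ 2 = \sum_(1 <= n < x.+1) mu ^+ 2.
    by rewrite sumr_const_nat subn1 mulr_natl.
  by rewrite -big_split/=; apply: eq_bigr => i _; ring.
have om n : (0 < n < x.+1)%N -> (size (primes n))%:R =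
    \sum_(1 <= p < x.+1 | prime p) (p %| n)%:R :> R.
  by rewrite ltnS; exact: omega_sum.
have H1 : x%:R * mu - x%:R <= \sum_(1 <= n < x.+1) (size (primes n))%:R.
  rewrite (eq_big_nat _ _ om) exchange_big/=.
  apply: (@le_trans _ _ (\sum_(1 <= p < x.+1 | prime p) (x%:R / p%:R - 1))).
    rewrite sumrB -mulr_sumr lerD2l lerN2 big_mkcond/=.
    apply: (@le_trans _ _ (\sum_(1 <= p < x.+1) 1)).
      by apply: ler_sum => i _; case: ifP.
    by rewrite sumr_const_nat subn1.
  apply: ler_sum => p pp; rewrite sum_dvdn_indic natr_divn_ge// prime_gt0//.
have H2 : \sum_(1 <= n < x.+1) (size (primes n))%:R ^+ 2 <= x%:R * mu ^+ 2 + x%:R * mu.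
  have -> : \sum_(1 <= n < x.+1) ((size (primes n))%:R : R) ^+ 2 =
    \sum_(1 <= n < x.+1) \sum_(1 <= p < x.+1 | prime p) \sum_(1 <= r < x.+1 | prime r)
       ((p %| n)%:R * (r %| n)%:R).
    apply: eq_big_nat => n hn; rewrite (om _ hn) expr2 mulr_suml.
    by apply: eq_bigr => p _; rewrite mulr_sumr.
  rewrite exchange_big/=.
  have -> : x%:R * mu ^+ 2 + x%:R * mu = \sum_(1 <= p < x.+1 | prime p)
      (x%:R / p%:R * mu + x%:R / p%:R).
    rewrite big_split/= -mulr_suml -mulr_sumr -/(recip_primes R x) -/mu; ring.
  rewrite big_nat_cond [leRHS]big_nat_cond; apply: ler_sum => p /andP[/andP[p1 px] pp].
  rewrite exchange_big/=.
  apply: (@le_trans _ _ (\sum_(1 <= r < x.+1 | prime r)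
     (x%:R / p%:R / r%:R + (r == p)%:R * (x%:R / p%:R)))).
    apply: ler_sum => r pr; have [->|rp] := eqVneq r p.
      rewrite mul1r; apply: (@le_trans _ _ (\sum_(1 <= n < x.+1) (p %| n)%:R)).
        by apply: ler_sum => n _; case: (p %| n)%N; rewrite ?mulr1 ?mulr0.
      rewrite sum_dvdn_indic; apply: le_trans (natr_divn_le _ _) _.
      by rewrite lerDr !divr_ge0.
    rewrite mul0r addr0.
    apply: (@le_trans _ _ (\sum_(1 <= n < x.+1) (p * r %| n)%:R)).
      apply: ler_sum => n _; rewrite Gauss_dvd; last by rewrite prime_coprime// dvdn_prime2// eq_sym.
      by case: (p %| n)%N; case: (r %| n)%N; rewrite ?mulr1 ?mulr0.
    rewrite sum_dvdn_indic; apply: le_trans (natr_divn_le _ _) _.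
    by rewrite natrM invfM mulrA.
  rewrite big_split/= -mulr_sumr lerD2l -mulr_suml ler_piMl ?divr_ge0//.
  exact/sum_delta_le/iota_uniq.
have h : mu * (x%:R * mu - x%:R) <= mu * \sum_(1 <= n < x.+1) (size (primes n))%:R.
  exact: ler_wpM2l.
lra.
Qed.

(** * Density of squarefree numbers *)

Definition squarefree n := all (fun p => ~~ (p ^ 2 %| n)%N) (primes n).

(** The primes 2 and 3 are counted exactly. Beyond them only odd numbers matter, and [1 / (t + 1)^2]
    is at most half of [1 / t - 1 / (t + 2)], which telescopes. *)
Lemma sum_prime_invsqr_even m :
  \sum_(1 <= p < (m.+2).*2.+1 | prime p) (p%:R ^+ 2)^-1 <=
    1 / 4 + 1 / 9 + (1 / 4 - ((m.+2).*2%:R)^-1) / 2 :> R.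
Proof.
elim: m => [|m IH].
  rewrite big_mkcond/= /index_iota/= !big_cons big_nil/=.
  have e2 : 2 ^+ 2 = 4 :> R by rewrite -natrX.
  have e3 : 3 ^+ 2 = 9 :> R by rewrite -natrX.
  by rewrite (_ : 2.*2 = 4)%N// e2 e3; lra.
rewrite [m.+3.*2]doubleS big_mkcond/= big_nat_recr//= big_nat_recr//= -big_mkcond/=.
have -> : prime m.+2.*2.+2 = false.
  by apply/negbTE/negP => /even_prime[|]; [lia|rewrite /= odd_double].
rewrite addr0.
apply: le_trans (lerD IH (lexx _)) _.
rewrite -[(m.+2).*2.+2%:R]natr1 -[(m.+2).*2.+1%:R]natr1.
have : (1 : R) <= (m.+2).*2%:R by rewrite ler1n; lia.
move: ((m.+2).*2%:R : R) => t t1.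
apply: (@le_trans _ _ (1 / 4 + 1 / 9 + (1 / 4 - t^-1) / 2 + ((t + 1) ^+ 2)^-1)).
  by rewrite lerD2l; case: ifP => // _; rewrite invr_ge0 exprn_ge0//; lra.
rewrite -subr_ge0.
have -> : 1 / 4 + 1 / 9 + (1 / 4 - (t + 1 + 1)^-1) / 2 -
   (1 / 4 + 1 / 9 + (1 / 4 - t^-1) / 2 + ((t + 1) ^+ 2)^-1) =
   (t * (t + 2) * (t + 1) ^+ 2)^-1.
  by field; rewrite !gt_eqF//; lra.
by rewrite invr_ge0 !mulr_ge0//; lra.
Qed.

(** [35/72 = 1/4 + 1/9 + 1/8]. It must be below one half, because a non-squarefree number will later
    cost 2. *)
Lemma sum_prime_invsqr_le n :
  \sum_(1 <= p < n.+1 | prime p) (p%:R ^+ 2)^-1 <= 35 / 72 :> R.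
Proof.
apply: (@le_trans _ _ (\sum_(1 <= p < (n.+2).*2.+1 | prime p) (p%:R ^+ 2)^-1)).
  rewrite (@big_cat_nat _ _ _ n.+1 1 (n.+2).*2.+1)//=; last by lia.
  by rewrite lerDl sumr_ge0// => i _; rewrite invr_ge0 exprn_ge0.
apply: le_trans (sum_prime_invsqr_even n) _.
have : 0 <= ((n.+2).*2%:R)^-1 :> R by [].
lra.
Qed.

Lemma sum_nonsquarefree_le x :
  \sum_(1 <= n < x.+1) (~~ squarefree n)%:R <= 35 / 72 * x%:R :> R.
Proof.
apply: (@le_trans _ _ (\sum_(1 <= n < x.+1) \sum_(1 <= p < x.+1 | prime p) (p ^ 2 %| n)%:R)).
  rewrite big_nat_cond [leRHS]big_nat_cond; apply: ler_sum => n /andP[/andP[n0 nx] _].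
  have [//|/allPn/=[p]] := boolP (squarefree n).
    by rewrite sumr_ge0.
  rewrite mem_primes negbK => /and3P[pp _ pn] p2n.
  rewrite big_mkcond/= (bigD1_seq p)/= ?iota_uniq//.
    by rewrite pp p2n lerDl sumr_ge0// => i _; case: ifP.
  by rewrite mem_index_iota prime_gt0//= (leq_ltn_trans _ nx)// dvdn_leq.
rewrite exchange_big/=.
apply: (@le_trans _ _ (\sum_(1 <= p < x.+1 | prime p) x%:R * (p%:R ^+ 2)^-1)).
  by apply: ler_sum => p pp; rewrite sum_dvdn_indic; apply: le_trans (natr_divn_le _ _) _; rewrite natrX.
by rewrite -mulr_sumr mulrC ler_wpM2r// sum_prime_invsqr_le.
Qed.
End TuranKubilius.

(** * Mean values of sparse multiplicative functions *)

Section LogTrick.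
Variable R : realType.
Implicit Types (n p d m x k : nat) (eta : R) (g : nat -> R).

(* The only properties of [|h|] that are needed, where [f' = 1 * h]: the values of
   [w] at higher prime powers are arbitrary, so [2] is the best bound there. *)
Record sparse_mult eta g : Prop := SparseMult {
  sparse_ge0 : forall n, 0 <= g n;
  sparse_one : g 1%N <= 1;
  sparse_prime : forall p m, prime p -> ~~ (p %| m)%N -> (0 < m)%N ->
    g (p * m)%N <= eta * g m;
  sparse_pow : forall p k m, prime p -> ~~ (p %| m)%N -> (0 < m)%N -> (1 < k)%N ->
    g (p ^ k * m)%N <= 2 * g m }.

Definition psum g x : R := \sum_(1 <= d < x.+1) g d.

(** Counts the [e] with [e^2] dividing [d]: a majorant for all sparse functions with [eta <= 1] at
    once, whose mean value stays bounded. *)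
Definition nb_square_divisors d : nat := \sum_(1 <= e < d.+1) (e ^ 2 %| d)%N.

Lemma nb_square_divisorsE d : (0 < d)%N ->
  nb_square_divisors d = size [seq e <- index_iota 1 d.+1 | (e ^ 2 %| d)%N].
Proof.
move=> d0; rewrite -sum1_size big_filter [RHS]big_mkcond.
by apply: eq_bigr => e _; case: (_ %| _)%N.
Qed.

Lemma nb_square_divisors_prime p m : prime p -> (0 < m)%N ->
  (nb_square_divisors m <= nb_square_divisors (p * m))%N.
Proof.
have p0 := prime_gt0 => pp m0; rewrite !nb_square_divisorsE//; last by rewrite muln_gt0 p0.
apply: uniq_leq_size => [|e]; first by rewrite filter_uniq ?iota_uniq.
rewrite !mem_filter !mem_index_iota => /and3P[em -> el].
rewrite dvdn_mull//= ltnS (leq_trans (_ : e <= m)%N)// ?leq_pmull ?prime_gt0//.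
Qed.

(** Every [e] with [e^2] dividing [m] yields two admissible numbers for [p ^ k * m], namely [e] and
    [p * e]; the two families are disjoint because [p] does not divide [m]. *)
Lemma nb_square_divisors_pow p k m : prime p -> ~~ (p %| m)%N -> (0 < m)%N -> (1 < k)%N ->
  (2 * nb_square_divisors m <= nb_square_divisors (p ^ k * m))%N.
Proof.
move=> pp pm m0 k1; have p0 := prime_gt0 pp.
have d0 : (0 < p ^ k * m)%N by rewrite muln_gt0 expn_gt0 p0.
rewrite !nb_square_divisorsE//.
set s := [seq e <- _ | _].
have -> : (2 * size s = size (s ++ [seq p * e | e <- s]))%N.
  by rewrite size_cat size_map mul2n addnn.
have sP e : e \in s -> [/\ (0 < e)%N & (e ^ 2 %| m)%N].
  by rewrite mem_filter mem_index_iota => /and3P[-> -> _].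
apply: uniq_leq_size => [|e].
  rewrite cat_uniq map_inj_uniq ?filter_uniq ?iota_uniq//=; last first.
    by move=> a b /eqP; rewrite eqn_pmul2l// => /eqP.
  rewrite andbT; apply/hasPn => e /mapP[a _ ->]; apply/negP => /sP[_ h].
  move/negP: pm; apply; apply: dvdn_trans h; rewrite expnMn dvdn_mulr//.
  by rewrite dvdn_exp.
have H a : (0 < a)%N -> (a ^ 2 %| p ^ k * m)%N ->
    a \in [seq e <- index_iota 1 (p ^ k * m).+1 | (e ^ 2 %| p ^ k * m)%N].
  move=> a0 ad; rewrite mem_filter mem_index_iota ad a0/= ltnS.
  by apply: leq_trans (dvdn_leq _ ad) => //; rewrite -{1}(expn1 a) leq_pexp2l.
rewrite mem_cat => /orP[/sP[e0 he]|/mapP[a /sP[a0 ha] ->]]; apply: H => //.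
- by rewrite dvdn_mull.
- by rewrite muln_gt0 p0.
- by rewrite expnMn dvdn_mul// dvdn_exp2l.
Qed.

Lemma sparse_le_nb_square_divisors eta g d : eta <= 1 -> sparse_mult eta g -> (0 < d)%N ->
  g d <= (nb_square_divisors d)%:R.
Proof.
move=> eta1 [g0 g1 gp gk]; elim/ltn_ind: d => d IH d0.
have [d1|d1] := leqP d 1.
  have -> : d = 1%N by lia.
  by rewrite /nb_square_divisors big_nat1.
have pp := pdiv_prime d1; set p := pdiv d in pp.
have pd : (p %| d)%N := pdiv_dvd d.
have [m cpm dm] := pfactor_coprime pp d0.
have k0 : (0 < logn p d)%N by rewrite logn_gt0 mem_primes pp d0.
move: (logn p d) k0 dm => k k0 dm.
have m0 : (0 < m)%N by move: d0; rewrite dm muln_gt0 => /andP[].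
have pm : ~~ (p %| m)%N by rewrite -prime_coprime.
have md : (m < d)%N.
  rewrite dm ltn_Pmulr//; apply: leq_trans (prime_gt1 pp) _.
  by rewrite -{1}(expn1 p) leq_pexp2l// prime_gt0.
have {}IH := IH _ md m0.
rewrite dm mulnC; have [k1|k1] := leqP k 1.
  have -> : k = 1%N by lia.
  rewrite expn1; apply: le_trans (gp _ _ pp pm m0) _.
  apply: (@le_trans _ _ (g m)); first by rewrite ler_piMl.
  by apply: le_trans IH _; rewrite ler_nat nb_square_divisors_prime.
apply: le_trans (gk _ _ _ pp pm m0 k1) _.
apply: (@le_trans _ _ (2 * nb_square_divisors m)%:R).
  by rewrite natrM ler_wpM2l.
by rewrite ler_nat nb_square_divisors_pow.
Qed.

Lemma sum_invsqr_le n : \sum_(1 <= e < n.+1) (e%:R ^+ 2)^-1 <= 2 :> R.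
Proof.
case: n => [|n]; first by rewrite big_geq.
suff H : \sum_(1 <= e < n.+2) (e%:R ^+ 2)^-1 <= 2 - n.+1%:R^-1 :> R.
  by apply: (le_trans H); rewrite gerBl.
elim: n => [|n IH]; first by rewrite big_nat1 expr1n invr1; lra.
rewrite big_nat_recr//=; apply: le_trans (lerD IH (lexx _)) _.
rewrite -[n.+2%:R]natr1; have : (1 : R) <= n.+1%:R by rewrite ler1n.
move: (n.+1%:R : R) => b b1; rewrite -subr_ge0.
have -> : 2 - (b + 1)^-1 - (2 - b^-1 + ((b + 1) ^+ 2)^-1) = (b * (b + 1) ^+ 2)^-1.
  by field; rewrite !gt_eqF//; lra.
by rewrite invr_ge0 !mulr_ge0//; lra.
Qed.

(** The starting bound, uniform in [eta]: exchanging the sums over [d] and [e] leaves [x] times the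
    sum of [1 / e^2]. *)
Lemma psum_le2 eta g x : eta <= 1 -> sparse_mult eta g -> psum g x <= 2 * x%:R.
Proof.
move=> eta1 sg.
apply: (@le_trans _ _ (\sum_(1 <= d < x.+1) \sum_(1 <= e < x.+1) (e ^ 2 %| d)%:R)).
  rewrite /psum big_nat_cond [leRHS]big_nat_cond; apply: ler_sum => d /andP[/andP[d0 dx] _].
  apply: le_trans (sparse_le_nb_square_divisors eta1 sg d0) _.
  rewrite /nb_square_divisors natr_sum (@big_cat_nat _ _ _ d.+1 1 x.+1)//=.
  by rewrite lerDl sumr_ge0.
rewrite exchange_big/=.
apply: (@le_trans _ _ (\sum_(1 <= e < x.+1) x%:R * (e%:R ^+ 2)^-1)).
  apply: ler_sum => e _; rewrite sum_dvdn_indic; apply: le_trans (natr_divn_le _ _ _) _.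
  by rewrite natrX.
by rewrite -mulr_sumr mulrC ler_wpM2r// sum_invsqr_le.
Qed.

Lemma psum_ge0 g x : (forall n, 0 <= g n) -> 0 <= psum g x.
Proof. by move=> g0; apply: sumr_ge0. Qed.

Lemma sum_logn_eq (V : nmodType) (F : nat -> V) p k x : prime p ->
  \sum_(1 <= d < x.+1 | logn p d == k) F d =
  \sum_(1 <= m < (x %/ p ^ k).+1 | ~~ (p %| m)%N) F (p ^ k * m)%N.
Proof.
move=> pp; have pk0 : (0 < p ^ k)%N by rewrite expn_gt0 prime_gt0.
rewrite -[LHS]big_filter -[RHS]big_filter -(big_map (fun m => p ^ k * m)%N xpredT F).
apply: perm_big; apply: uniq_perm.
- by rewrite filter_uniq ?iota_uniq.
- rewrite map_inj_uniq ?filter_uniq ?iota_uniq// => a b /eqP.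
  by rewrite eqn_pmul2l// => /eqP.
move=> d; rewrite mem_filter mem_index_iota; apply/idP/mapP.
  move=> /and3P[/eqP ld d0 dx]; have [m cpm dm] := pfactor_coprime pp d0.
  rewrite ld in dm; exists m; last by rewrite mulnC.
  rewrite mem_filter mem_index_iota -prime_coprime// cpm/= ltnS leq_divRL// -dm.
  by rewrite (dx : (d <= x)%N) andbT; move: d0; rewrite dm muln_gt0 => /andP[-> _].
move=> [m]; rewrite mem_filter mem_index_iota => /and3P[pm m0 mx] ->.
rewrite muln_gt0 pk0 m0/= lognM// pfactorK// logn_coprime ?prime_coprime//.
by rewrite addn0 eqxx/= ltnS mulnC -leq_divRL.
Qed.

Lemma sum_logn_eq_le g p k x (c : R) : prime p -> 0 <= c -> (forall n, 0 <= g n) ->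
  (forall m, ~~ (p %| m)%N -> (0 < m)%N -> g (p ^ k * m)%N <= c * g m) ->
  \sum_(1 <= d < x.+1 | logn p d == k) g d <= c * psum g (x %/ p ^ k).
Proof.
move=> pp c0 g0 H; rewrite sum_logn_eq// /psum mulr_sumr big_mkcond/=.
rewrite big_nat_cond [leRHS]big_nat_cond; apply: ler_sum => m /andP[/andP[m0 _] _].
by case: ifPn => [pm|_]; [exact: H|rewrite mulr_ge0].
Qed.

(** Sort [d] by the exact power [p ^ k] dividing it. The case [k = 1] gains [eta]; for [k >= 2] the
    trivial bound gives [4 x k / p^k], and these sum to at most [24 x / p^2]. *)
Lemma sum_logn_weight_le eta g p x : 0 <= eta <= 1 -> sparse_mult eta g -> prime p ->
  (0 < x)%N ->
  \sum_(1 <= d < x.+1) (logn p d)%:R * g d <=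
    eta * psum g (x %/ p) + 24 * x%:R / p%:R ^+ 2.
Proof.
move=> /andP[eta0 eta1] sg pp x0; have [g0 _ gp gk] := sg.
have -> : \sum_(1 <= d < x.+1) (logn p d)%:R * g d =
  \sum_(1 <= k < x.+1) k%:R * \sum_(1 <= d < x.+1 | logn p d == k) g d.
  under [RHS]eq_bigr do rewrite mulr_sumr big_mkcond/=.
  rewrite exchange_big/=; apply: eq_big_nat => d /andP[d0 dx].
  have [l0|l0] := posnP (logn p d).
    rewrite l0 mul0r big_nat_cond big1// => k /andP[/andP[k0 _] _].
    by rewrite ifF// lt_eqF.
  rewrite (bigD1_seq (logn p d))/= ?iota_uniq//; last first.
    rewrite mem_index_iota l0/=; apply: leq_trans dx; exact/ltnW/ltn_logl.
  by rewrite eqxx big1 ?addr0// => k kl; rewrite ifF// eq_sym (negbTE kl).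
rewrite big_ltn// mul1r; apply: lerD.
  have := @sum_logn_eq_le g p 1 x eta pp eta0 g0; rewrite expn1; apply=> m pm m0.
  exact: gp.
have pR : (2 : R) <= p%:R by rewrite ler_nat prime_gt1.
apply: (@le_trans _ _ (\sum_(2 <= k < x.+1) 4 * x%:R * (k%:R * (p%:R^-1) ^+ k))).
  rewrite big_nat_cond [leRHS]big_nat_cond; apply: ler_sum => k /andP[/andP[k1 _] _].
  rewrite mulrCA ler_wpM2l//.
  apply: (@le_trans _ _ (2 * psum g (x %/ p ^ k))).
    by apply: sum_logn_eq_le => // m pm m0; exact: gk.
  apply: (@le_trans _ _ (2 * (2 * (x %/ p ^ k)%:R))).
    by rewrite ler_wpM2l// (psum_le2 _ eta1 sg).
  have := @natr_divn_le R x (p ^ k); rewrite natrX exprVn; lra.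
rewrite -mulr_sumr; case: x x0 => // x _.
apply: le_trans (ler_wpM2l _ (sum_mul_expr_le _ _)) _ => //.
  by rewrite invr_ge0 (le_trans _ pR)//= -div1r ler_pdivrMr; lra.
by apply: le_of_eq; rewrite exprVn; field; rewrite gt_eqF//; lra.
Qed.

Lemma ln_logn d x : (0 < d <= x)%N ->
  ln d%:R = \sum_(1 <= p < x.+1 | prime p) (logn p d)%:R * ln p%:R :> R.
Proof.
move=> /andP[d0 dx].
rewrite -{1}(partnT d0) (widen_partn _ dx) ln_prod_nat; last first.
  by move=> p _; exact: pfactor_gt0.
rewrite big_ltn_cond//= expn0 ln1 add0r [RHS]big_mkcond/=.
apply: eq_big_nat => p /andP[p0 _].
case: ifPn => [pp|np]; first by rewrite natrX lnXn ?ltr0n// mulr_natl.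
by rewrite lognE (negbTE np)/= expn0 ln1.
Qed.

Definition logsum g x : R := \sum_(1 <= m < x.+1) g m / m%:R.

(** Summing over pairs [m p <= x] with [m] outside turns the inner sum into [chebyshev_theta] at
    [x %/ m], which is at most [2 x / m]. *)
Lemma sum_ln_psum_le g x : (forall n, 0 <= g n) ->
  \sum_(1 <= p < x.+1 | prime p) ln p%:R * psum g (x %/ p) <= 2 * x%:R * logsum g x.
Proof.
move=> g0.
have -> : \sum_(1 <= p < x.+1 | prime p) ln p%:R * psum g (x %/ p) =
   \sum_(1 <= m < x.+1) g m * chebyshev_theta R (x %/ m).
  have -> : \sum_(1 <= p < x.+1 | prime p) ln p%:R * psum g (x %/ p) =
    \sum_(1 <= p < x.+1 | prime p) \sum_(1 <= m < x.+1)
       (if (m * p <= x)%N then g m * ln p%:R else 0).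
    apply: eq_bigr => p pp; rewrite /psum mulr_sumr.
    rewrite (@big_nat_widen _ _ _ _ _ x.+1) ?ltnS ?leq_div// big_mkcond/=.
    by apply: eq_bigr => m _; rewrite ltnS leq_divRL ?prime_gt0// mulrC.
  rewrite exchange_big/=; apply: eq_big_nat => m /andP[m0 _].
  rewrite /chebyshev_theta mulr_sumr.
  rewrite [RHS](@big_nat_widen _ _ _ _ _ x.+1) ?ltnS ?leq_div// -big_mkcondr/=.
  by apply: eq_bigl => p; rewrite ltnS leq_divRL// mulnC.
rewrite /logsum mulr_sumr; apply: ler_sum => m _.
have h := le_trans (chebyshev_theta_le R (x %/ m)) (ler_wpM2l (ler0n R 2) (natr_divn_le R x m)).
by apply: le_trans (ler_wpM2l (g0 m) h) _; apply: le_of_eq; ring.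
Qed.

(* [ln d] is the sum of [v_p(d) ln p]; the exact prime divisors of [d] contribute a
   factor [eta], the higher powers only [O(x)], and Chebyshev's bound does the rest. *)
Lemma sum_mul_ln_le eta g x : 0 <= eta <= 1 -> sparse_mult eta g -> (0 < x)%N ->
  \sum_(1 <= d < x.+1) g d * ln d%:R <= 2 * eta * x%:R * logsum g x + 48 * x%:R.
Proof.
move=> he sg x0; have g0 := sparse_ge0 sg.
have -> : \sum_(1 <= d < x.+1) g d * ln d%:R =
  \sum_(1 <= p < x.+1 | prime p) ln p%:R * \sum_(1 <= d < x.+1) (logn p d)%:R * g d.
  under [RHS]eq_bigr do rewrite mulr_sumr.
  rewrite exchange_big/=; apply: eq_big_nat => d hd.
  by rewrite (@ln_logn d x) ?mulr_sumr//; apply: eq_bigr => p _; ring.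
apply: (@le_trans _ _ (\sum_(1 <= p < x.+1 | prime p)
   (eta * (ln p%:R * psum g (x %/ p)) + 24 * x%:R * (ln p%:R / p%:R ^+ 2)))).
  apply: ler_sum => p pp.
  apply: le_trans (ler_wpM2l (ln_natr_ge0 _ _) (sum_logn_weight_le he sg pp x0)) _.
  by apply: le_of_eq; ring.
rewrite big_split/= -!mulr_sumr; apply: lerD.
  have h := sum_ln_psum_le x g0; have /andP[e0 _] := he.
  by have := ler_wpM2l e0 h; lra.
have : \sum_(1 <= p < x.+1 | prime p) ln p%:R / p%:R ^+ 2 <= 2 :> R.
  apply: le_trans (sum_ln_div_sqr R x); rewrite big_mkcond/=.
  case: x x0 => // x _; rewrite big_ltn//= add0r [leRHS]big_nat_recr//= ler_wpDr//.
    by rewrite divr_ge0 ?ln_natr_ge0 ?exprn_ge0.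
  by apply: ler_sum => i _; case: ifP => // _; rewrite divr_ge0 ?ln_natr_ge0 ?exprn_ge0.
have : (0 : R) <= x%:R by [].
nra.
Qed.

(** Going from [x] to [x + 1] increases the sum by [psum g x] times [ln (x + 1) - ln x], hence by at
    most 2. *)
Lemma sum_mul_ln_ratio_le eta g x : eta <= 1 -> sparse_mult eta g ->
  \sum_(1 <= d < x.+1) g d * (ln x%:R - ln d%:R) <= 2 * x%:R.
Proof.
move=> e1 sg; elim: x => [|x IH]; first by rewrite big_geq// mulr0.
rewrite big_nat_recr//= subrr mulr0 addr0.
have [->|x0] := posnP x; first by rewrite big_geq.
have -> : \sum_(1 <= d < x.+1) g d * (ln x.+1%:R - ln d%:R) =
   \sum_(1 <= d < x.+1) g d * (ln x%:R - ln d%:R) + (ln x.+1%:R - ln x%:R) * psum g x.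
  by rewrite /psum mulr_sumr -big_split/=; apply: eq_bigr => d _; ring.
have xR : (0 : R) < x%:R by rewrite ltr0n.
have hl : ln x.+1%:R - ln x%:R <= x%:R^-1 :> R.
  rewrite -ln_div ?posrE//; apply: le_trans (ln_subr1_le _) _; first by rewrite divr_gt0.
  by rewrite -[x.+1%:R]natr1 mulrDl mulfV ?gt_eqF// mul1r addrAC subrr add0r.
have h2 : (ln x.+1%:R - ln x%:R) * psum g x <= x%:R^-1 * (2 * x%:R).
  apply: ler_pM => //; first by rewrite subr_ge0 ler_ln_nat.
    exact/psum_ge0/(sparse_ge0 sg).
  exact: psum_le2 e1 sg.
have -> : 2 * x.+1%:R = 2 * x%:R + 2 :> R by rewrite -[x.+1%:R]natr1; ring.
apply: lerD => //.
by apply: le_trans h2 _; rewrite mulrCA mulVf ?gt_eqF// mulr1.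
Qed.

Lemma psum_mul_ln_le eta g x : 0 <= eta <= 1 -> sparse_mult eta g -> (0 < x)%N ->
  psum g x * ln x%:R <= x%:R * (2 * eta * logsum g x + 50).
Proof.
move=> he sg x0; have /andP[_ e1] := he.
have h1 := sum_mul_ln_le he sg x0; have h2 := sum_mul_ln_ratio_le x e1 sg.
have -> : psum g x * ln x%:R = \sum_(1 <= d < x.+1) g d * ln d%:R +
    \sum_(1 <= d < x.+1) g d * (ln x%:R - ln d%:R).
  by rewrite -big_split mulr_suml/=; apply: eq_bigr => d _; ring.
lra.
Qed.

Lemma logsum_parts g x : (0 < x)%N ->
  logsum g x = psum g x / x%:R + \sum_(1 <= j < x) psum g j / (j%:R * j.+1%:R).
Proof.
rewrite /logsum; elim: x => // -[|x] IH _.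
  by rewrite /psum !big_nat1 big_geq// addr0.
rewrite big_nat_recr//= IH// [X in _ = _ + X]big_nat_recr//=.
have -> : psum g x.+2 = psum g x.+1 + g x.+2 by rewrite /psum big_nat_recr.
move: (psum g x.+1) (g x.+2) (\sum_(_ <= _ < _) _) => a b s.
have : (0 : R) < x.+1%:R by rewrite ltr0n.
rewrite -[x.+2%:R]natr1; move: (x.+1%:R : R) => t t0.
by field; rewrite !gt_eqF//; lra.
Qed.

Lemma harmonic_trunc_le (Y : R) x : 0 <= Y ->
  \sum_(1 <= j < x.+1 | ln j%:R < Y) j%:R^-1 <= 1 + Y :> R.
Proof.
move=> Y0; elim: x => [|x IH]; first by rewrite big_geq// addr_ge0.
have [h|h] := ltP (ln x.+1%:R) Y.
  apply: le_trans (_ : 1 + ln x.+1%:R <= _); last by rewrite lerD2l ltW.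
  apply: le_trans (harmonic_le _ _) => //; rewrite big_mkcond/=.
  by apply: ler_sum => i _; case: ifP.
by rewrite big_mkcond/= big_nat_recr//= -big_mkcond/= ltNge h addr0.
Qed.

(** After partial summation, the indices with [ln j < Y] are handled by the trivial bound [2 j] on
    [psum], the others by the hypothesis. *)
Lemma logsum_le eta g x (A Y : R) : eta <= 1 -> sparse_mult eta g -> (0 < x)%N ->
  0 <= A -> 0 <= Y ->
  (forall j, (0 < j)%N -> Y <= ln j%:R -> psum g j <= A * j%:R) ->
  logsum g x <= 4 + A + A * ln x%:R + 2 * Y.
Proof.
move=> e1 sg x0 A0 Y0 H; rewrite logsum_parts//.
have h1 : psum g x / x%:R <= 2 by rewrite ler_pdivrMr ?ltr0n// (psum_le2 _ e1 sg).
suff h2 : \sum_(1 <= j < x) psum g j / (j%:R * j.+1%:R) <=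
   A * (1 + ln x%:R) + 2 * (1 + Y) by lra.
apply: (@le_trans _ _ (\sum_(1 <= j < x.+1) (A * j%:R^-1 + 2 * (if ln j%:R < Y then j%:R^-1 else 0)))).
  rewrite big_nat_recr//= ler_wpDr//.
    by rewrite addr_ge0 ?mulr_ge0//; case: ifP.
  rewrite big_nat_cond [leRHS]big_nat_cond; apply: ler_sum => j /andP[/andP[j0 _] _].
  have jR : (0 : R) < j%:R by rewrite ltr0n.
  apply: (@le_trans _ _ (psum g j / j%:R / j%:R)).
    rewrite -mulrA -invfM ler_wpM2l ?psum_ge0//; first exact: sparse_ge0 sg.
    by rewrite lef_pV2 ?posrE ?mulr_gt0// ler_wpM2l ?ler_nat// ltW.
  have [h|h] := ltP.
    rewrite -mulrDl ler_wpM2r// ler_pdivrMr//.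
    by have := psum_le2 j e1 sg; have := mulr_ge0 A0 (ltW jR); lra.
  by rewrite mulr0 addr0 ler_wpM2r// ler_pdivrMr// H.
rewrite big_split/= -!mulr_sumr -big_mkcond/=; apply: lerD; apply: ler_wpM2l => //.
  exact: harmonic_le.
exact: harmonic_trunc_le.
Qed.

(* Each use of [psum_mul_ln_le], with [logsum] bounded by partial summation from the
   previous step, gains one more factor [eta]. *)
Lemma psum_power_saving (i : nat) : exists D : R, exists e : nat, 1 <= D /\
  forall eta g x, 0 < eta <= 1 -> sparse_mult eta g -> (0 < x)%N ->
    D <= eta ^+ e * ln x%:R -> psum g x <= D * eta ^+ i * x%:R.
Proof.
elim: i => [|i [D [e [D1 IH]]]].
  exists 2, 0%N; split; first by lra.
  by move=> eta g x /andP[_ e1] sg _ _; rewrite expr0 mulr1; exact: psum_le2 e1 sg.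
exists (8 * D + 58), (e + i.+1)%N; split; first by lra.
move=> eta g x /andP[e0 e1] sg x0 hx.
have hE : 0 < eta ^+ e by exact: exprn_gt0.
have hI : 0 < eta ^+ i by exact: exprn_gt0.
have hE1 : eta ^+ e <= 1 by rewrite exprn_ile1// ltW.
have hI1 : eta ^+ i <= 1 by rewrite exprn_ile1// ltW.
have lx0 : 0 < ln x%:R :> R.
  have : 0 < eta ^+ (e + i.+1) * ln x%:R by apply: lt_le_trans hx; lra.
  by rewrite pmulr_rgt0// exprn_gt0.
(* The cutoff [Y = D / eta ^ e] is where the previous step becomes available. The exponent
   [e + i.+1] ensures that [1 / eta ^ e], hence every error term, is absorbed by
   [eta ^ i.+1 * ln x]. *)
have hM : logsum g x <= 4 + D * eta ^+ i + D * eta ^+ i * ln x%:R + 2 * (D / eta ^+ e).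
  apply: (logsum_le e1 sg x0); first by rewrite mulr_ge0 ?ltW//; lra.
    by rewrite divr_ge0 ?ltW//; lra.
  move=> j j0 hj; apply: IH => //; first by rewrite e0.
  by rewrite mulrC -ler_pdivrMr.
have he : 0 <= eta <= 1 by rewrite ltW.
have h := psum_mul_ln_le he sg x0.
rewrite -(ler_pM2r lx0); apply: (le_trans h).
have xR : (0 : R) < x%:R by rewrite ltr0n.
rewrite [leRHS](_ : _ = x%:R * ((8 * D + 58) * eta ^+ i.+1 * ln x%:R)); last by ring.
rewrite ler_pM2l//.
have hb : (58 + 6 * D) / eta ^+ e <= (58 + 6 * D) * eta ^+ i.+1 * ln x%:R.
  rewrite -mulrA; apply: ler_wpM2l; first by lra.
  rewrite -div1r ler_pdivrMr//.
  apply: (@le_trans _ _ (8 * D + 58)); first by lra.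
  by apply: le_trans hx _; rewrite exprD; apply: le_of_eq; ring.
have hc : 2 * eta * (4 + D * eta ^+ i + 2 * (D / eta ^+ e)) + 50 <= (58 + 6 * D) / eta ^+ e.
  have u1 : 1 <= (eta ^+ e)^-1 by rewrite invf_ge1.
  have u2 : 0 <= D * eta ^+ i <= D by apply/andP; split; [rewrite mulr_ge0 ?ltW//; lra|rewrite ler_piMr//; lra].
  move: ((eta ^+ e)^-1) u1 => u u1; move: (D * eta ^+ i) u2 => v /andP[v0 vD].
  have a1 : eta * (4 + v + 2 * (D * u)) <= 4 + v + 2 * (D * u).
    by rewrite ler_piMl// !addr_ge0// !mulr_ge0//; lra.
  have a2 : D <= D * u by rewrite ler_peMr//; lra.
  lra.
have hd := ler_wpM2l (ltW e0) hM.
rewrite exprS in hb *; nra.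
Qed.

End LogTrick.

(** * Convolution and exponential sums *)

Section Convolution.
Variable R : realType.
Implicit Types (n p d m x k q : nat) (F : nat -> R[i]) (u z : R[i]).

Lemma cnormD u z : normc (u + z) <= normc u + normc z.
Proof. exact: (@le_normcD R u z). Qed.

Lemma cnormN u : normc (- u) = normc u.
Proof. exact: (@normcN R u). Qed.

Lemma cnormBC u z : normc (u - z) = normc (z - u).
Proof. by rewrite -cnormN opprB. Qed.

Lemma cnormB u z : normc (u - z) <= normc u + normc z.
Proof. by rewrite -(cnormN z) cnormD. Qed.

Lemma cnorm_ge0 u : 0 <= normc u.
Proof. by case: u => a b; rewrite /normc sqrtr_ge0. Qed.

Lemma cnormX u k : normc (u ^+ k) = normc u ^+ k.
Proof.
elim: k => [|k IH]; first by rewrite !expr0; exact: normc1.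
by rewrite !exprS normcM IH.
Qed.

Lemma cnorm_expr1 u k : normc u = 1 -> normc (u ^+ k) = 1.
Proof. by move=> u1; rewrite cnormX u1 expr1n. Qed.

Lemma cnorm_sum (I : Type) (r : seq I) (P : pred I) (E : I -> R[i]) :
  normc (\sum_(i <- r | P i) E i) <= \sum_(i <- r | P i) normc (E i).
Proof.
elim/big_ind2: _ => // [|a b c d ab cd]; first by rewrite normc0.
by apply: le_trans (cnormD _ _) _; exact: lerD.
Qed.

(** Factor [u ^ a - 1] as [u - 1] times a sum of [a] numbers of modulus 1. *)
Lemma cnormX_sub_le u k m : normc u = 1 ->
  normc (u ^+ k - u ^+ m) <= normc (u - 1) * `|k%:R - m%:R|.
Proof.
move=> u1.
have H a : normc (u ^+ a - 1) <= normc (u - 1) * a%:R.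
  rewrite subrX1 normcM ler_wpM2l ?cnorm_ge0//; apply: le_trans (cnorm_sum _ _ _) _.
  under eq_bigr do rewrite cnorm_expr1//.
  by rewrite sumr_const card_ord.
wlog mk : k m / (m <= k)%N.
  move=> W; have [|/ltnW] := leqP m k; first exact: W.
  by rewrite cnormBC distrC; exact: W.
have -> : u ^+ k - u ^+ m = u ^+ m * (u ^+ (k - m) - 1).
  by rewrite mulrBr mulr1 -exprD subnKC.
by rewrite normcM cnorm_expr1// mul1r -natrB// normr_nat.
Qed.

(** Complete periods of length [q] sum to 0, so fewer than [q] terms of modulus 1 survive. *)
Lemma root_of_unity_sum_le u q x : (0 < q)%N -> u ^+ q = 1 -> u != 1 -> normc u = 1 ->
  normc (\sum_(1 <= j < x.+1) u ^+ j) <= q%:R.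
Proof.
move=> q0 uq u1 nu.
have z : \sum_(1 <= j < q.+1) u ^+ j = 0.
  rewrite big_add1/= big_mkord; under eq_bigr do rewrite exprS.
  rewrite -mulr_sumr; have := subrX1 u q; rewrite uq subrr => /esym/eqP.
  by rewrite mulf_eq0 subr_eq0 (negbTE u1)/= => /eqP ->; rewrite mulr0.
elim/ltn_ind: x => x IH; have [xq|qx] := ltnP x q.
  apply: le_trans (cnorm_sum _ _ _) _; under eq_bigr do rewrite cnorm_expr1//.
  by rewrite sumr_const_nat subn1 ler_nat ltnW.
rewrite (@big_cat_nat _ _ _ q.+1)//= z add0r.
have -> : \sum_(q.+1 <= j < x.+1) u ^+ j = \sum_(1 <= j < (x - q).+1) u ^+ j.
  rewrite -[q.+1]add1n big_addn subSn//.
  by apply: eq_bigr => j _; rewrite exprD uq mulr1.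
by apply: IH; lia.
Qed.

(** * Möbius inversion for multiplicative functions *)

Definition mult_fun F := F 1%N = 1 /\ forall m n, (0 < m)%N -> (0 < n)%N ->
  coprime m n -> F (m * n)%N = F m * F n.

(** For multiplicative [F] this is the Dirichlet convolution of [F] with the Möbius function, the
    [h] of [F = 1 * h]. The Euler product form makes its values at prime powers immediate. *)
Definition mobius_transform F n : R[i] :=
  \prod_(p <- primes n) (F (p ^ logn p n)%N - F (p ^ (logn p n).-1)%N).

Lemma mobius_transform1 F : mobius_transform F 1 = 1.
Proof. by rewrite /mobius_transform big_nil. Qed.

Lemma perm_primes_pow p k m : prime p -> ~~ (p %| m)%N -> (0 < m)%N -> (0 < k)%N ->
  perm_eq (primes (p ^ k * m)) (p :: primes m).
Proof.
move=> pp pm m0 k0; have pk0 : (0 < p ^ k)%N by rewrite expn_gt0 prime_gt0.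
apply: uniq_perm; rewrite /= ?primes_uniq ?andbT ?mem_primes ?(negbTE pm) ?andbF//.
by move=> r; rewrite primesM// primesX// primes_prime// inE in_cons.
Qed.

Lemma mobius_transform_pow F p k m : prime p -> ~~ (p %| m)%N -> (0 < m)%N -> (0 < k)%N ->
  mobius_transform F (p ^ k * m) =
    (F (p ^ k)%N - F (p ^ k.-1)%N) * mobius_transform F m.
Proof.
move=> pp pm m0 k0; have pk0 : (0 < p ^ k)%N by rewrite expn_gt0 prime_gt0.
rewrite /mobius_transform (perm_big _ (perm_primes_pow pp pm m0 k0))/= big_cons.
have -> : logn p (p ^ k * m) = k.
  by rewrite lognM// pfactorK// logn_coprime ?addn0// prime_coprime.
congr (_ * _); rewrite big_seq [RHS]big_seq; apply: eq_bigr => r.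
rewrite mem_primes => /and3P[rp _ rm].
have -> : logn r (p ^ k * m) = logn r m; last by [].
rewrite lognM// lognX logn_prime//; have [e|_] := eqVneq r p; last by rewrite muln0.
by rewrite -e rm in pm.
Qed.

Lemma perm_divisors_pow p k m : prime p -> ~~ (p %| m)%N -> (0 < m)%N ->
  perm_eq (divisors (p ^ k * m)) [seq (p ^ j * e)%N | j <- index_iota 0 k.+1, e <- divisors m].
Proof.
move=> pp pm m0; have pj0 j : (0 < p ^ j)%N by rewrite expn_gt0 prime_gt0.
have n0 : (0 < p ^ k * m)%N by rewrite muln_gt0 pj0.
have lg j e : (e %| m)%N -> logn p (p ^ j * e) = j.
  move=> em; have e0 : (0 < e)%N by exact: dvdn_gt0 em.
  rewrite lognM// pfactorK// logn_coprime ?addn0// prime_coprime//.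
  by apply: contra pm => /dvdn_trans; exact.
apply: uniq_perm; first exact: divisors_uniq.
  apply: allpairs_uniq; [exact: iota_uniq|exact: divisors_uniq|].
  move=> [j e] [j' e'] h1 h2 /= E.
  case/allpairsP: h1 => [[a b] /= [_ hb [? ?]]]; case/allpairsP: h2 => [[a' b'] /= [_ hb' [? ?]]]; subst.
  rewrite -dvdn_divisors// in hb; rewrite -dvdn_divisors// in hb'.
  have ea : a = a' by rewrite -(lg a b hb) E lg.
  by rewrite -ea in E *; congr (_, _); move/eqP: E; rewrite eqn_pmul2l// => /eqP.
move=> d; rewrite -dvdn_divisors//; apply/idP/allpairsP => [dn|[[j e] /= [hj he ->]]].
  have d0 : (0 < d)%N by exact: dvdn_gt0 dn.
  have [e cpe de] := pfactor_coprime pp d0.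
  exists (logn p d, e); split => /=; last by rewrite mulnC.
    rewrite mem_index_iota/= ltnS.
    by apply: leq_trans (dvdn_leq_log _ n0 dn) _; rewrite lg.
  rewrite -dvdn_divisors//.
  have : (e %| p ^ k * m)%N by apply: dvdn_trans dn; rewrite de dvdn_mulr.
  by rewrite Gauss_dvdr// coprime_sym coprimeXl.
rewrite mem_index_iota ltnS in hj; rewrite -dvdn_divisors// in he.
by rewrite dvdn_mul// dvdn_exp2l.
Qed.

(** Split off a prime power [p ^ k]. The sum over exponents [j >= 1] telescopes to
    [F (p ^ k) - F 1], and the exponent 0 restores [F 1 = 1]. *)
Lemma mobius_transform_sum F n : mult_fun F -> (0 < n)%N ->
  \sum_(d <- divisors n) mobius_transform F d = F n.
Proof.
move=> [F1 FM]; elim/ltn_ind: n => n IH n0.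
have [n1|n1] := leqP n 1.
  have -> : n = 1%N by lia.
  by rewrite big_seq1 mobius_transform1.
have pp := pdiv_prime n1; set p := pdiv n in pp.
have [m cpm nm] := pfactor_coprime pp n0.
have k0 : (0 < logn p n)%N by rewrite logn_gt0 mem_primes pp n0 pdiv_dvd.
move: (logn p n) k0 nm => k k0 nm.
have m0 : (0 < m)%N by move: n0; rewrite nm muln_gt0 => /andP[].
have pm : ~~ (p %| m)%N by rewrite -prime_coprime.
have mn : (m < n)%N.
  rewrite nm ltn_Pmulr//; apply: leq_trans (prime_gt1 pp) _.
  by rewrite -{1}(expn1 p) leq_pexp2l// prime_gt0.
have pk0 : (0 < p ^ k)%N by rewrite expn_gt0 prime_gt0.
rewrite nm mulnC (perm_big _ (perm_divisors_pow k pp pm m0)) big_allpairs_dep/=.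
rewrite big_ltn//= FM//; last by rewrite coprimeXl.
have -> : \sum_(e <- divisors m) mobius_transform F (p ^ 0 * e) = F m.
  by rewrite -IH//; apply: eq_bigr => e _; rewrite expn0 mul1n.
have -> : \sum_(1 <= j < k.+1) \sum_(e <- divisors m) mobius_transform F (p ^ j * e) =
  \sum_(1 <= j < k.+1) (F (p ^ j)%N - F (p ^ j.-1)%N) * F m.
  apply: eq_big_nat => j /andP[j0 _]; rewrite -(IH m)// mulr_sumr.
  rewrite big_seq [RHS]big_seq; apply: eq_bigr => e; rewrite -dvdn_divisors// => em.
  rewrite mobius_transform_pow//; last exact: dvdn_gt0 em.
  by apply: contra pm => /dvdn_trans; exact.
rewrite -mulr_suml big_add1/= telescope_sumr// expn0 F1.
by rewrite mulrBl mul1r addrC subrK.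
Qed.

Lemma sum_dvdn_eq (V : nmodType) (E : nat -> V) d x : (0 < d)%N ->
  \sum_(1 <= n < x.+1 | (d %| n)%N) E n = \sum_(1 <= j < (x %/ d).+1) E (d * j)%N.
Proof.
move=> d0; rewrite -[LHS]big_filter -(big_map (fun j => d * j)%N xpredT E).
apply: perm_big; apply: uniq_perm.
- by rewrite filter_uniq ?iota_uniq.
- by rewrite map_inj_uniq ?iota_uniq// => a b /eqP; rewrite eqn_pmul2l// => /eqP.
move=> n; rewrite mem_filter mem_index_iota; apply/idP/mapP.
  move=> /and3P[/dvdnP[j ->] n0 nx]; exists j; last by rewrite mulnC.
  by rewrite mem_index_iota ltnS leq_divRL// (nx : (j * d <= x)%N) andbT; move: n0; rewrite muln_gt0 => /andP[].
move=> [j]; rewrite mem_index_iota => /andP[j0 jx] ->.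
by rewrite dvdn_mulr//= muln_gt0 d0 j0/= ltnS mulnC -leq_divRL.
Qed.

(** With [F = 1 * h], the multiples of [d] form a geometric sum of ratio [u ^ d], a [q]-th root of
    unity. It is at most [q] unless [u ^ d = 1], and those [d] carry no weight. *)
Lemma mult_fun_exp_sum_le F u q x : mult_fun F -> (0 < q)%N -> u ^+ q = 1 -> normc u = 1 ->
  (forall d, (0 < d)%N -> u ^+ d = 1 -> mobius_transform F d = 0) ->
  normc (\sum_(1 <= n < x.+1) F n * u ^+ n) <=
    q%:R * psum (fun d => normc (mobius_transform F d)) x.
Proof.
move=> mF q0 uq nu H.
have -> : \sum_(1 <= n < x.+1) F n * u ^+ n =
  \sum_(1 <= d < x.+1) mobius_transform F d * \sum_(1 <= j < (x %/ d).+1) (u ^+ d) ^+ j.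
  have -> : \sum_(1 <= n < x.+1) F n * u ^+ n = \sum_(1 <= n < x.+1) \sum_(1 <= d < x.+1)
      (if (d %| n)%N then mobius_transform F d * u ^+ n else 0).
    apply: eq_big_nat => n /andP[n0 nx]; rewrite -(mobius_transform_sum mF n0) mulr_suml.
    rewrite -big_mkcond/= -[RHS]big_filter; apply: perm_big; apply: uniq_perm.
    - exact: divisors_uniq.
    - by rewrite filter_uniq ?iota_uniq.
    move=> d; rewrite -dvdn_divisors// mem_filter mem_index_iota.
    apply/idP/andP => [dn|[]//]; split => //.
    by rewrite (dvdn_gt0 n0 dn)/= (leq_ltn_trans _ nx)// dvdn_leq.
  rewrite exchange_big/=; apply: eq_big_nat => d /andP[d0 _].
  rewrite -big_mkcond/= sum_dvdn_eq// mulr_sumr.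
  by apply: eq_bigr => j _; rewrite exprM.
apply: le_trans (cnorm_sum _ _ _) _; rewrite /psum mulr_sumr.
rewrite big_nat_cond [leRHS]big_nat_cond; apply: ler_sum => d /andP[/andP[d0 _] _].
rewrite normcM mulrC; have [ud|ud] := eqVneq (u ^+ d) 1.
  by rewrite H// normc0 !mulr0.
rewrite ler_wpM2r ?cnorm_ge0// root_of_unity_sum_le//; last exact: cnorm_expr1.
by rewrite exprAC uq expr1n.
Qed.

Lemma mobius_transform_sparse F (eta : R) : mult_fun F ->
  (forall n, normc (F n) = 1) -> (forall p, prime p -> normc (F p - 1) <= eta) ->
  sparse_mult eta (fun d => normc (mobius_transform F d)).
Proof.
move=> [F1 FM] nF Fp; split => [n||p m pp pm m0|p k m pp pm m0 k1].
- exact: cnorm_ge0.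
- by rewrite mobius_transform1 normc1.
- rewrite -{1}(expn1 p) mobius_transform_pow// expn0 expn1 F1 normcM.
  by rewrite ler_wpM2r ?cnorm_ge0// Fp.
- rewrite mobius_transform_pow//; last exact: ltnW.
  rewrite normcM ler_wpM2r ?cnorm_ge0//; apply: le_trans (cnormB _ _) _.
  by rewrite !nF; lra.
Qed.

End Convolution.

(** * The exponential sum over [n + w n] *)

Section ExponentialSum.
Variable R : realType.
Implicit Types (n p d m x k q : nat) (z : R[i]) (w : nat -> nat).

Lemma additive_arith1 w : additive_arith w -> w 1%N = 0%N.
Proof. by move=> wadd; have := wadd 1%N 1%N isT isT isT; rewrite muln1; lia. Qed.

Lemma additive_arith_squarefree w n : additive_arith w ->
  (forall p, prime p -> w p = 1%N) -> (0 < n)%N -> squarefree n -> w n = size (primes n).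
Proof.
move=> wadd wp; elim/ltn_ind: n => n IH n0 sn.
have [n1|n1] := leqP n 1.
  have -> : n = 1%N by lia.
  by rewrite additive_arith1.
have pp := pdiv_prime n1; have pn := pdiv_dvd n; set p := pdiv n in pp pn.
have [m cpm nm] := pfactor_coprime pp n0.
have hp : p \in primes n by rewrite mem_primes pp n0.
have k1 : logn p n = 1%N.
  apply/eqP; rewrite eqn_leq logn_gt0 hp andbT leqNgt -pfactor_dvdn//.
  exact: (allP sn).
rewrite k1 expn1 in nm.
have m0 : (0 < m)%N by move: n0; rewrite nm muln_gt0 => /andP[].
have pm : ~~ (p %| m)%N by rewrite -prime_coprime.
have mn : (m < n)%N by rewrite nm ltn_Pmulr// prime_gt1.
have sm : squarefree m.
  apply/allP => r; rewrite mem_primes => /and3P[rp _ rm].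
  have : ~~ (r ^ 2 %| n)%N by apply: (allP sn); rewrite mem_primes rp n0 nm dvdn_mulr.
  by apply: contra => h; rewrite nm dvdn_mulr.
have := perm_size (perm_primes_pow pp pm m0 (isT : (0 < 1)%N)).
rewrite expn1 mulnC -nm => -> /=.
rewrite {1}nm wadd//; [|exact: prime_gt0|by rewrite coprime_sym].
by rewrite (wp _ pp) IH// addn1.
Qed.

(* Each non-squarefree number costs at most [2], in total [35/36 x]; Turan's
   inequality makes the squarefree terms agree with one fixed power of [z] up to
   [x / 72] in total. *)
Lemma sum_expr_additive_ge w z x : additive_arith w ->
  (forall p, prime p -> w p = 1%N) -> normc z = 1 ->
  72 * 144 * (normc (z - 1) ^+ 2 * (3 * recip_primes R x + 1)) <= 1 ->
  x%:R / 72 <= normc (\sum_(1 <= n < x.+1) z ^+ w n).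
Proof.
move=> wadd wp z1; set eta := normc (z - 1); set mu := recip_primes R x => hmu.
have eta0 : 0 <= eta := cnorm_ge0 _.
have mu0 : 0 <= mu := recip_primes_ge0 R x.
(* An exponent of [z] must be an integer, so the mean [mu] is replaced by its integer part [k], at
   distance at most 1. *)
have /andP[k1 k2] := truncn_itv mu0; set k := Num.truncn mu in k1 k2.
rewrite -natr1 in k2.
have term n : (0 < n)%N -> normc (z ^+ w n - z ^+ k) <=
    2 * (~~ squarefree n)%:R + (1 / 144 + 36 * eta ^+ 2 * (2 * ((size (primes n))%:R - mu) ^+ 2 + 2)).
  move=> n0; have [sn|sn] /= := boolP (squarefree n).
    rewrite mulr0 add0r (additive_arith_squarefree wadd wp n0 sn).
    apply: le_trans (cnormX_sub_le _ _ z1) _; rewrite -/eta.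
    move: ((size (primes n))%:R : R) (k%:R : R) k1 k2 => s t k1 k2.
    (* From [(6 v - 1/12)^2 >= 0]: a first-order deviation is traded for a small constant and a
       second-order one, which Turan's inequality controls. *)
    have a1 : eta * `|s - t| <= 1 / 144 + 36 * eta ^+ 2 * (s - t) ^+ 2.
      rewrite -[(s - t) ^+ 2]real_normK ?num_real//.
      rewrite -mulrA -exprMn; move: (eta * _) => v.
      by have := sqr_ge0 (6 * v - 1 / 12); rewrite !expr2; lra.
    apply: (le_trans a1); rewrite lerD2l ler_wpM2l ?mulr_ge0 ?exprn_ge0//.
    have := sqr_ge0 ((s - mu) - (mu - t)).
    have : (mu - t) ^+ 2 <= 1 by rewrite expr_le1//; lra.
    by rewrite !expr2; lra.
  rewrite mulr1; apply: le_trans (cnormB _ _) _; rewrite !cnorm_expr1//.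
  have : 0 <= 36 * eta ^+ 2 * (2 * ((size (primes n))%:R - mu) ^+ 2 + 2).
    by rewrite !mulr_ge0 ?exprn_ge0// addr_ge0// mulr_ge0// sqr_ge0.
  lra.
have e : \sum_(1 <= n < x.+1) z ^+ k = \sum_(1 <= n < x.+1) z ^+ w n
   - \sum_(1 <= n < x.+1) (z ^+ w n - z ^+ k).
  by rewrite sumrB opprB addrC subrK.
have e2 : normc (\sum_(1 <= n < x.+1) z ^+ k) = x%:R.
  rewrite sumr_const_nat subn1/= (@normcMn R (z ^+ k) x).
  by rewrite -[RHS]mulr1 mulr_natl; congr (_ *+ _); exact: cnorm_expr1.
have h1 : x%:R <= normc (\sum_(1 <= n < x.+1) z ^+ w n) +
   normc (\sum_(1 <= n < x.+1) (z ^+ w n - z ^+ k)).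
  by rewrite -e2 e cnormB.
have h2 : normc (\sum_(1 <= n < x.+1) (z ^+ w n - z ^+ k)) <= x%:R * (71 / 72).
  apply: le_trans (cnorm_sum _ _ _) _.
  apply: (@le_trans _ _ (\sum_(1 <= n < x.+1) (2 * (~~ squarefree n)%:R +
      (1 / 144 + 36 * eta ^+ 2 * (2 * ((size (primes n))%:R - mu) ^+ 2 + 2))))).
    by rewrite big_nat_cond [leRHS]big_nat_cond; apply: ler_sum => n /andP[/andP[n0 _] _]; exact: term.
  have -> : \sum_(1 <= n < x.+1) (2 * (~~ squarefree n)%:R +
      (1 / 144 + 36 * eta ^+ 2 * (2 * ((size (primes n))%:R - mu) ^+ 2 + 2))) =
      2 * \sum_(1 <= n < x.+1) (~~ squarefree n)%:R + x%:R * (1 / 144 + 72 * eta ^+ 2) +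
      72 * eta ^+ 2 * \sum_(1 <= n < x.+1) ((size (primes n))%:R - mu) ^+ 2.
    have -> : x%:R * (1 / 144 + 72 * eta ^+ 2) = \sum_(1 <= n < x.+1) (1 / 144 + 72 * eta ^+ 2).
      by rewrite sumr_const_nat subn1 mulr_natl.
    by rewrite !mulr_sumr -!big_split/=; apply: eq_bigr => n _; ring.
  (* The shares of [x] are [35/36] from non-squarefree numbers, [1/144] from the constant, and at
     most [1/144] from the variance by [hmu]; their total is [71/72]. *)
  have a1 := sum_nonsquarefree_le R x.
  have a2 := turan_kubilius R x; rewrite -/mu in a2.
  have a3 := ler_wpM2l (exprn_ge0 2 eta0) a2.
  have a4 := ler_wpM2l (ler0n R x) hmu.
  lra.
lra.
Qed.

(** Otherwise Bezout gives [a d = b q + 1], and then [z = z ^ (a d) = 1]. *)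
Lemma root_of_unity_prime_dvd z q d : prime q -> z ^+ q = 1 -> z != 1 -> z ^+ d = 1 -> (q %| d)%N.
Proof.
move=> pq zq z1 zd; apply: contraNT z1; rewrite -prime_coprime// coprime_sym => cqd.
have [d0|d0] := posnP d; last first.
  have [[a b] /= ab] := coprimeP _ d0 cqd.
  have e : (a * d = b * q + 1)%N by lia.
  have : z ^+ (a * d) = z by rewrite e exprD expr1 mulnC exprM zq expr1n mul1r.
  by rewrite mulnC exprM zd expr1n => <-.
by move: cqd; rewrite d0 /coprime gcd0n => /eqP q1; move: pq; rewrite q1.
Qed.

Definition qfree_part q n : nat := partn n (negn (q : nat_pred)).

Lemma qfree_part_id q n : prime q -> ~~ (q %| n)%N -> qfree_part q n = n.
Proof. by move=> pq qn; rewrite /qfree_part part_pnat_id// p'natE. Qed.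

Lemma qfree_part_pow q k m : prime q -> ~~ (q %| m)%N -> (0 < m)%N ->
  qfree_part q (q ^ k * m) = m.
Proof.
move=> pq qm m0; rewrite /qfree_part partnM//; last by rewrite expn_gt0 prime_gt0.
rewrite [partn m _]part_pnat_id ?p'natE// part_p'nat ?mul1n//.
by rewrite pnatNK pnatX pnat_id.
Qed.

(** Split the exponential sum into the sum with [f'], the part from [n] exactly divisible by [q],
    and the part from multiples of [q^2]; isolate the middle one. The witness [g] is the modulus of
    the transform of [f']. *)
Lemma exp_sum_ge w z q N : additive_arith w -> (forall p, prime p -> w p = 1%N) ->
  prime q -> z ^+ q = 1 -> z != 1 -> normc z = 1 ->
  exists2 g : nat -> R, sparse_mult (normc (z - 1)) g &
    normc (z - 1) * normc (\sum_(1 <= m < (N %/ q).+1 | ~~ (q %| m)%N) z ^+ w m) <=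
    normc (\sum_(1 <= n < N.+1) z ^+ (n + w n)) + 2 * (N%:R / q%:R ^+ 2) + q%:R * psum g N.
Proof.
move=> wadd wp pq zq z1 nz.
have w1 := additive_arith1 wadd.
pose f n := z ^+ w n; pose f' n := z ^+ w (qfree_part q n).
have nf' n : normc (f' n) = 1 by exact: cnorm_expr1.
have mf' : mult_fun f'.
  split; first by rewrite /f' /qfree_part partn1 w1.
  move=> m n m0 n0 cmn; rewrite /f' /qfree_part partnM// wadd ?part_gt0 ?exprD//.
  exact: coprime_dvdl (dvdn_part _ _) (coprime_dvdr (dvdn_part _ _) cmn).
have f'q k : f' (q ^ k)%N = 1.
  rewrite /f' -[(q ^ k)%N]muln1 qfree_part_pow// ?w1//.
  by rewrite dvdn1 gtn_eqF// prime_gt1.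
exists (fun d => normc (mobius_transform f' d)).
  apply: mobius_transform_sparse => // p pp; have [->|pq'] := eqVneq p q.
    by rewrite -[q]expn1 f'q subrr normc0 cnorm_ge0.
  by rewrite /f' qfree_part_id// ?wp ?expr1// dvdn_prime2// eq_sym.
have q0 := prime_gt0 pq.
have H1 : normc (\sum_(1 <= n < N.+1) f' n * z ^+ n) <=
    q%:R * psum (fun d => normc (mobius_transform f' d)) N.
  (* A [d] with [z ^ d = 1] is a multiple of [q], and the transform vanishes there because [f']
     equals 1 at every power of [q]. *)
  apply: mult_fun_exp_sum_le => // d d0 zd.
  have qd := root_of_unity_prime_dvd pq zq z1 zd.
  have [m cqm dm] := pfactor_coprime pq d0.
  have m0 : (0 < m)%N by move: d0; rewrite dm muln_gt0 => /andP[].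
  rewrite dm mulnC mobius_transform_pow// -?prime_coprime// ?logn_gt0 ?mem_primes ?pq ?d0//.
  by rewrite !f'q subrr mul0r.
have H2 : \sum_(1 <= n < N.+1) z ^+ (n + w n) = \sum_(1 <= n < N.+1) f' n * z ^+ n +
   ((z - 1) * \sum_(1 <= m < (N %/ q).+1 | ~~ (q %| m)%N) z ^+ w m +
    \sum_(1 <= n < N.+1 | (q ^ 2 %| n)%N) (f n - f' n) * z ^+ n).
  have -> : (z - 1) * \sum_(1 <= m < (N %/ q).+1 | ~~ (q %| m)%N) z ^+ w m =
    \sum_(1 <= n < N.+1 | logn q n == 1%N) (f n - f' n) * z ^+ n.
    rewrite sum_logn_eq// expn1 mulr_sumr big_nat_cond [RHS]big_nat_cond.
    apply: eq_bigr => m /andP[/andP[m0 _] qm].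
    have e := @qfree_part_pow q 1 m pq qm m0; rewrite expn1 in e.
    rewrite exprM zq expr1n mulr1 /f /f' e.
    by rewrite wadd// ?prime_coprime// (wp _ pq) exprD expr1 mulrBl mul1r.
  rewrite [X in _ + (X + _)]big_mkcond [X in _ + (_ + X)]big_mkcond -!big_split/=.
  apply: eq_big_nat => n /andP[n0 _].
  have [qn|qn] := boolP (q %| n)%N; last first.
    have -> : logn q n = 0%N by apply: logn_coprime; rewrite prime_coprime.
    have -> : (q ^ 2 %| n)%N = false.
      by apply/negbTE; apply: contra qn; apply: dvdn_trans; rewrite dvdn_exp.
    by rewrite /= /f' qfree_part_id// !addr0 exprD mulrC.
  have l0 : (0 < logn q n)%N by rewrite logn_gt0 mem_primes pq n0.
  rewrite pfactor_dvdn//; have [->|l1] := eqVneq (logn q n) 1%N.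
    by rewrite /= addr0 -mulrDl addrC subrK exprD mulrC.
  rewrite (_ : (1 < logn q n)%N); last by lia.
  by rewrite add0r -mulrDl addrC subrK exprD mulrC.
have H3 : normc (\sum_(1 <= n < N.+1 | (q ^ 2 %| n)%N) (f n - f' n) * z ^+ n) <=
    2 * (N%:R / q%:R ^+ 2).
  apply: le_trans (cnorm_sum _ _ _) _.
  apply: (@le_trans _ _ (\sum_(1 <= n < N.+1 | (q ^ 2 %| n)%N) 2)).
    apply: ler_sum => n _; rewrite normcM (cnorm_expr1 _ nz) mulr1.
    by apply: le_trans (cnormB _ _) _; rewrite nf' cnorm_expr1//; lra.
  rewrite sum_dvdn_eq ?expn_gt0 ?q0// sumr_const_nat subn1/= -[X in X <= _]mulr_natr ler_wpM2l//.
  by apply: le_trans (natr_divn_le _ _ _) _; rewrite natrX.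
rewrite -normcM; set A := (z - 1) * _ in H2 *.
have -> : A = \sum_(1 <= n < N.+1) z ^+ (n + w n)
    - \sum_(1 <= n < N.+1 | (q ^ 2 %| n)%N) (f n - f' n) * z ^+ n
    - \sum_(1 <= n < N.+1) f' n * z ^+ n by rewrite H2; ring.
apply: le_trans (cnormB _ _) _; apply: lerD => //.
by apply: le_trans (cnormB _ _) _; exact: lerD.
Qed.

(* Choose a preimage for each [m <= N] that is not exceptional: the chosen terms form
   the geometric sum without its exceptional terms, and [Xi w N] terms remain. *)
Lemma exp_sum_le_Xi w z q N : (0 < q)%N -> z ^+ q = 1 -> z != 1 -> normc z = 1 ->
  normc (\sum_(1 <= n < N.+1) z ^+ (n + w n)) <= q%:R + 2 * (Xi w N)%:R.
Proof.
move=> q0 zq z1 nz; set r := index_iota 1 N.+1.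
have ur : uniq r by exact: iota_uniq.
pose E := [seq m <- r | `[< exceptional w m >] ].
pose M := [seq m <- r | ~~ `[< exceptional w m >] ].
have XiE : Xi w N = size E.
  have -> : Xi w N = #|` [fset x in E]%fset|.
    rewrite /Xi; congr (#|` _|); rewrite -[RHS]set_fsetK; congr fset_set.
    have inE' (x : nat) : (x \in [fset x in E]%fset) = (x \in E) by rewrite !inE.
    apply/seteqP; split => x /=; rewrite inE' mem_filter mem_index_iota ltnS.
      by move=> [/andP[-> ->] ex]; rewrite /= andbT; apply/asboolP.
    by move=> /andP[/asboolP ex x12]; split.
  by rewrite card_fseq undup_id// filter_uniq.
(* A preimage of [m] is at most [m], so the search may stop at [m]. The default 0 is never reached
   for [m] in [M]. *)
pose c m := nth 0%N [seq n <- index_iota 1 m.+1 | (n + w n == m)%N] 0.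
have cP m : m \in M -> (c m + w (c m) = m)%N /\ (0 < c m <= N)%N.
  rewrite mem_filter mem_index_iota => /and3P[/asboolP nex m0 mN].
  have [n n0 e] : exists2 n, (0 < n)%N & m = (n + w n)%N.
    by apply: contrapT => h; apply: nex; split.
  have : c m \in [seq n <- index_iota 1 m.+1 | (n + w n == m)%N].
    apply: mem_nth; rewrite size_filter -has_count; apply/hasP; exists n; last by rewrite e.
    by rewrite mem_index_iota n0 e ltnS leq_addr.
  rewrite mem_filter mem_index_iota => /and3P[/eqP h1 h2 h3]; split => //.
  by rewrite h2/=; move: h3 mN; rewrite !ltnS; exact: leq_trans.
pose J := map c M.
have uM : uniq M by rewrite filter_uniq.
(* The map [c] is injective on [M], since [m] is recovered as [c m + w (c m)]. *)
have uJ : uniq J.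
  rewrite map_inj_in_uniq// => a b /cP[ha _] /cP[hb _] e.
  by rewrite -ha -hb e.
pose J' := [seq n <- r | n \notin J].
have pJ : perm_eq r (J ++ J').
  apply: uniq_perm => //.
    rewrite cat_uniq uJ filter_uniq//= andbT; apply/hasPn => n.
    by rewrite mem_filter => /andP[].
  move=> n; rewrite mem_cat mem_filter; have [nJ|//] := boolP (n \in J).
  by case/mapP: nJ => m /cP[_ h] ->; rewrite /= mem_index_iota ltnS.
have pE : perm_eq r (E ++ M) by rewrite perm_sym perm_filterC.
have sJ' : size J' = size E.
  by have := perm_size pJ; rewrite (perm_size pE) !size_cat size_map addnC => /addnI.
have eM : \sum_(n <- J) z ^+ (n + w n) = \sum_(m <- M) z ^+ m.
  rewrite big_map big_seq [RHS]big_seq; apply: eq_bigr => m /cP[h _].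
  by rewrite h.
have eM' : \sum_(m <- M) z ^+ m = \sum_(1 <= m < N.+1) z ^+ m - \sum_(m <- E) z ^+ m.
  by rewrite (perm_big _ pE) big_cat/= addrC addrK.
have triv (s : seq nat) (e : nat -> nat) : normc (\sum_(n <- s) z ^+ e n) <= (size s)%:R.
  apply: le_trans (cnorm_sum _ _ _) _; under eq_bigr do rewrite cnorm_expr1//.
  by rewrite -sum1_size natr_sum.
rewrite (perm_big _ pJ) big_cat/= eM eM'.
apply: le_trans (cnormD _ _) _; rewrite XiE mulr2n mulrDl mul1r addrA.
apply: lerD; last by rewrite -sJ'; exact: triv.
apply: le_trans (cnormB _ _) _; apply: lerD; last exact: (triv E id).
exact: root_of_unity_sum_le.
Qed.

End ExponentialSum.

(** * The lower bound *)

Section RootsOfUnity.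
Variable R : realType.
Implicit Types (t : R) (q a k : nat).

Lemma sin_mvt t : 0 <= t -> exists2 c, 0 <= c <= t & sin t = cos c * t.
Proof.
move=> t0; have [|c] := @MVT_segment R sin cos 0 t t0 (fun x _ => is_derive_sin x).
  exact/continuous_subspaceT/continuous_sin.
by rewrite in_itv/= sin0 !subr0 => hc e; exists c.
Qed.

Lemma sin_le_id t : 0 <= t -> sin t <= t.
Proof. by move=> t0; have [c _ ->] := sin_mvt t0; rewrite ler_piMl// cos_le1. Qed.

(** By the mean value theorem it suffices that the cosine is at least one half on [[0, 1]]; this
    follows from [cos c = 1 - 2 sin (c/2)^2] and [|sin (c/2)| <= c/2]. *)
Lemma sin_ge_half t : 0 <= t <= 1 -> t / 2 <= sin t.
Proof.
move=> /andP[t0 t1]; have [c /andP[c0 ct] ->] := sin_mvt t0.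
rewrite mulrC ler_wpM2r//.
have c20 : 0 <= c / 2 by rewrite divr_ge0.
have [b _ hb] := sin_mvt c20.
have e : cos c = 1 - 2 * sin (c / 2) ^+ 2.
  have {1}-> : c = (c / 2) *+ 2 by rewrite -mulr_natr divfK.
  by rewrite cos_mulr2n cos2sin2 mulr2n; ring.
have h : sin (c / 2) ^+ 2 <= (c / 2) ^+ 2.
  by rewrite hb exprMn ler_piMl ?exprn_ge0// -real_normK ?num_real// expr_le1// cos_max.
have : (c / 2) ^+ 2 <= (1 / 2) ^+ 2 by rewrite ler_sqr ?nnegrE//; lra.
rewrite e; move: h; rewrite [(1 / 2) ^+ 2]expr2; lra.
Qed.

Lemma complexM (a b c d : R) :
  Complex a b * Complex c d = Complex (a * c - b * d) (a * d + b * c) :> R[i].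
Proof. by []. Qed.

Lemma complexB1 (a b : R) : Complex a b - 1 = Complex (a - 1) b :> R[i].
Proof. by rewrite -[LHS]/(Complex (a - 1) (b - 0)) subr0. Qed.

(** Take [z = e(a/q)]. With [t = pi a / q] one has [|z - 1| = 2 sin t], which lies between [t] and
    [2 t] because [4 a <= q] and [pi <= 4] force [t <= 1]. *)
Lemma exists_root_of_unity q a : (0 < a)%N -> (4 * a <= q)%N ->
  exists z : R[i], [/\ z ^+ q = 1, normc z = 1,
    2 * a%:R / q%:R <= normc (z - 1) & normc (z - 1) <= 8 * a%:R / q%:R].
Proof.
move=> a0 aq; have qR : (0 : R) < q%:R by rewrite ltr0n; lia.
have aR : (0 : R) < a%:R by rewrite ltr0n.
have aqR : 4 * a%:R <= q%:R :> R by rewrite -natrM ler_nat.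
pose t : R := pi * a%:R / q%:R.
have p2 := pi_ge2 R; have p4 : pi <= 4 :> R by have := pihalf_lt2 R; lra.
have t_ge : 2 * a%:R / q%:R <= t by rewrite ler_pM2r ?invr_gt0// ler_pM2r.
have t_le : t <= 4 * a%:R / q%:R by rewrite ler_pM2r ?invr_gt0// ler_pM2r.
have t0 : 0 <= t by apply: le_trans t_ge; rewrite divr_ge0 ?mulr_ge0// ltW.
have t1 : t <= 1 by apply: (le_trans t_le); rewrite ler_pdivrMr// mul1r.
pose z : R[i] := Complex (cos (t *+ 2)) (sin (t *+ 2)).
have zX k : z ^+ k = Complex (cos (t *+ 2 *+ k)) (sin (t *+ 2 *+ k)).
  elim: k => [|k IH]; first by rewrite expr0 mulr0n cos0 sin0.
  by rewrite exprS IH complexM !mulrS -cosD [X in Complex _ X]addrC -sinD.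
have s0 : 0 <= sin t by have := @sin_ge_half t; rewrite t0 t1 => /(_ isT); lra.
have nz : normc (z - 1) = 2 * sin t.
  have -> : z - 1 = Complex (- (2 * sin t ^+ 2)) (2 * (cos t * sin t)).
    rewrite /z complexB1 cos_mulr2n sin_mulr2n cos2sin2.
    by congr Complex; rewrite !mulr2n; ring.
  rewrite /normc (_ : _ + _ = (2 * sin t) ^+ 2); last first.
    have := cos2Dsin2 t => h.
    rewrite (_ : (2 * sin t) ^+ 2 = 4 * sin t ^+ 2 * (cos t ^+ 2 + sin t ^+ 2)); first ring.
    by rewrite h; ring.
  by rewrite sqrtr_sqr ger0_norm// mulr_ge0.
exists z; split.
- rewrite zX -mulrnA mulnC mulrnA.
  have -> : t *+ q *+ 2 = (pi *+ 2) *+ a.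
    rewrite -(mulr_natr (t *+ q) 2) -(mulr_natr t q) -(mulr_natr (pi *+ 2) a) -(mulr_natr pi 2).
    by rewrite /t; field; exact: lt0r_neq0.
  have h1 := periodicn (@cosD2pi R) a 0; have h2 := periodicn (@sinD2pi R) a 0.
  by rewrite !add0r in h1 h2; rewrite h1 h2 cos0 sin0.
- by rewrite /z /normc cos2Dsin2 sqrtr1.
- by rewrite nz; have := @sin_ge_half t; rewrite t0 t1 => /(_ isT); lra.
- by rewrite nz; have := sin_le_id t0; lra.
Qed.

(** [expR L] is at least [(L / (e + 1)) ^ (e + 1)], one power of [L] more than required; [B] pays
    for the constants. *)
Lemma expR_ge_poly (D K : R) (e : nat) : 0 <= D -> 0 <= K ->
  exists B : R, forall L, B <= L -> D * (K * L) ^+ e <= expR L.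
Proof.
move=> D0 K0; exists (Num.max 0 (D * K ^+ e * e.+1%:R ^+ e.+1)) => L.
rewrite ge_max => /andP[L0 hL].
have h : (L / e.+1%:R) ^+ e.+1 <= expR L.
  have -> : expR L = expR (L / e.+1%:R) ^+ e.+1.
    by rewrite -expRM_natl; congr expR; rewrite mulrC divfK.
  rewrite lerXn2r ?nnegrE ?expR_ge0 ?divr_ge0//.
  by apply: le_trans (expR_ge1Dx _); rewrite lerDr.
apply: le_trans h.
rewrite expr_div_n ler_pdivlMr ?exprn_gt0// exprMn [L ^+ e.+1]exprSr.
rewrite (_ : D * _ * _ = L ^+ e * (D * K ^+ e * e.+1%:R ^+ e.+1)); last by ring.
by rewrite ler_wpM2l// exprn_ge0.
Qed.

End RootsOfUnity.

(** * Choice of the parameters and conclusion *)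

Section LowerBound.
Variable R : realType.

(** Compares the two estimates of the exponential sum for fixed [q] and [a]; the numerical
    hypotheses are what makes every error smaller than the main term. *)
Lemma Xi_ge (D : R) (e : nat) (w : nat -> nat) (N q a : nat) :
  0 <= D ->
  (forall (eta : R) g x, 0 < eta <= 1 -> sparse_mult eta g -> (0 < x)%N ->
    D <= eta ^+ e * ln x%:R -> psum g x <= D * eta ^+ 4 * x%:R) ->
  additive_arith w -> (forall p, prime p -> w p = 1%N) -> prime q ->
  (4 * 144 <= a)%N -> (8 * a <= q)%N ->
  72 * 144 * ((8 * a%:R / q%:R) ^+ 2 * (3 * recip_primes R N + 1)) <= 1 ->
  D * (8 * a%:R) ^+ 4 <= q%:R -> D * q%:R ^+ e <= ln N%:R -> 2 * q%:R ^+ 3 <= N%:R :> R ->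
  N%:R / (4 * q%:R ^+ 2) <= (Xi w N)%:R :> R.
Proof.
move=> D0 HD wadd wp pq a_ge aq hmu hq1 hq2 hN.
have a0 : (0 < a)%N by exact: leq_trans a_ge.
have aR : 4 * 144 <= a%:R :> R by rewrite -natrM ler_nat.
have qR : 8 * a%:R <= q%:R :> R by rewrite -natrM ler_nat.
have aq4 : (4 * a <= q)%N by apply: leq_trans aq; rewrite leq_mul2r orbT.
have [z [zq nz eta_ge eta_le]] := @exists_root_of_unity R q a a0 aq4.
set eta := normc (z - 1) in eta_ge eta_le.
have q0 : (0 : R) < q%:R by lra.
have eta0 : 0 < eta by apply: lt_le_trans eta_ge; rewrite divr_gt0//; lra.
have eta1 : eta <= 1 by apply: (le_trans eta_le); rewrite ler_pdivrMr// mul1r.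
have z1 : z != 1 by apply: contraTneq eta0 => zz; rewrite /eta zz subrr normc0 ltxx.
have [g sg hS] := exp_sum_ge N wadd wp pq zq z1 nz; rewrite -/eta in sg hS.
have hX := exp_sum_le_Xi w N (prime_gt0 pq) zq z1 nz.
set S := normc (\sum_(1 <= n < N.+1) _) in hS hX.
have N0 : (0 : R) < N%:R by apply: lt_le_trans hN; rewrite mulr_gt0// exprn_gt0.
have N0' : (0 < N)%N by rewrite -(ltr0n R).
(* As [eta <= 8 a / q], the fourth power of [eta] turns [q * psum g N] into [D (8 a)^4 N / q^3], and
   one further [q] absorbs the constant. This is why the saving is taken with exponent 4. *)
have hG : q%:R * psum g N <= N%:R / q%:R ^+ 2.
  have h1 : psum g N <= D * eta ^+ 4 * N%:R.
    apply: HD => //; first by rewrite eta0.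
    have qe : (0 : R) < q%:R ^+ e by exact: exprn_gt0.
    have h : (q%:R^-1) ^+ e <= eta ^+ e.
      apply: lerXn2r; rewrite ?nnegrE ?invr_ge0 ?ltW//.
      by apply: lt_le_trans eta_ge; rewrite -[X in X < _]mul1r ltr_pM2r ?invr_gt0//; lra.
    apply: le_trans (ler_wpM2r (ln_natr_ge0 R N) h).
    by rewrite exprVn mulrC ler_pdivlMr.
  have h2 : eta ^+ 4 <= (8 * a%:R) ^+ 4 / q%:R ^+ 4.
    by rewrite -expr_div_n; apply: lerXn2r; rewrite ?nnegrE ?divr_ge0// ltW.
  apply: (@le_trans _ _ (q%:R * (D * ((8 * a%:R) ^+ 4 / q%:R ^+ 4) * N%:R))).
    rewrite ler_pM2l//; apply: (le_trans h1).
    by rewrite ler_pM2r// ler_wpM2l.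
  rewrite (_ : _ * (_ * N%:R) = D * (8 * a%:R) ^+ 4 * (N%:R / q%:R ^+ 3)); last by field; exact: lt0r_neq0.
  apply: (@le_trans _ _ (q%:R * (N%:R / q%:R ^+ 3))).
    by rewrite ler_wpM2r// divr_ge0// exprn_ge0.
  by apply: le_of_eq; field; exact: lt0r_neq0.
set x := (N %/ q)%N in hS.
have x_ge : N%:R / (2 * q%:R) <= x%:R :> R.
  apply: le_trans (natr_divn_ge R N (prime_gt0 pq)).
  have : 1 <= N%:R / (2 * q%:R) :> R.
    rewrite ler_pdivlMr ?mul1r ?mulr_gt0//; apply: le_trans hN.
    by rewrite ler_pM2l// -[X in X <= _]expr1 ler_eXn2l//; lra.
  have -> : N%:R / q%:R = 2 * (N%:R / (2 * q%:R)) :> R by field; exact: lt0r_neq0.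
  lra.
(* Removing the multiples of [q] costs at most [x / q <= x / 144], half of the bound [x / 72]. *)
have hA : x%:R / 144 <= normc (\sum_(1 <= m < x.+1 | ~~ (q %| m)%N) z ^+ w m).
  have h1 : x%:R / 72 <= normc (\sum_(1 <= n < x.+1) z ^+ w n).
    apply: sum_expr_additive_ge => //; apply: le_trans hmu; rewrite -/eta.
    rewrite ler_pM2l//; apply: ler_pM.
    - by rewrite exprn_ge0// ltW.
    - by rewrite addr_ge0// mulr_ge0// recip_primes_ge0.
    - by apply: lerXn2r; rewrite ?nnegrE ?divr_ge0// ltW.
    - by rewrite lerD2r ler_wpM2l// recip_primes_mono// leq_div.
  have h2 : normc (\sum_(1 <= n < x.+1 | (q %| n)%N) z ^+ w n) <= x%:R / 144.
    apply: le_trans (cnorm_sum _ _ _) _; under eq_bigr do rewrite cnorm_expr1//.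
    rewrite sum_dvdn_eq ?prime_gt0// sumr_const_nat subn1/=.
    apply: le_trans (natr_divn_le _ _ _) _; rewrite ler_wpM2l// lef_pV2 ?posrE//; lra.
  have e1 : \sum_(1 <= m < x.+1 | ~~ (q %| m)%N) z ^+ w m = \sum_(1 <= n < x.+1) z ^+ w n
     - \sum_(1 <= n < x.+1 | (q %| n)%N) z ^+ w n.
    by rewrite [X in _ = X - _](bigID (fun n => q %| n)%N)/= addrC addrK.
  have : normc (\sum_(1 <= n < x.+1) z ^+ w n) <=
     normc (\sum_(1 <= m < x.+1 | ~~ (q %| m)%N) z ^+ w m) +
     normc (\sum_(1 <= n < x.+1 | (q %| n)%N) z ^+ w n).
    by rewrite e1; apply: le_trans (cnormD _ _); rewrite subrK.
  lra.
(* [eta >= 2 a / q] and [x >= N / (2 q)] give [(a / 144) N / q^2]; hence the requirement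
   [a >= 4 * 144], which beats the three units of error. *)
have hB : 4 * (N%:R / q%:R ^+ 2) <= eta * normc (\sum_(1 <= m < x.+1 | ~~ (q %| m)%N) z ^+ w m).
  apply: (@le_trans _ _ (2 * a%:R / q%:R * (N%:R / (2 * q%:R) / 144))).
    have -> : 2 * a%:R / q%:R * (N%:R / (2 * q%:R) / 144) = a%:R / 144 * (N%:R / q%:R ^+ 2) :> R.
      by field; exact: lt0r_neq0.
    by apply: ler_wpM2r; [rewrite divr_ge0// exprn_ge0// ltW|lra].
  apply: ler_pM => //.
  by apply: le_trans hA; rewrite ler_wpM2r.
(* The exponential sum is at least [N / q^2] and at most [q + 2 Xi]; here [q] takes at most half of
   [N / q^2]. *)
have hq3 : q%:R <= N%:R / q%:R ^+ 2 / 2 :> R.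
  rewrite ler_pdivlMr// ler_pdivlMr ?exprn_gt0//; apply: le_trans hN.
  by apply: le_of_eq; ring.
rewrite (_ : N%:R / (4 * q%:R ^+ 2) = N%:R / q%:R ^+ 2 / 4); last by field; exact: lt0r_neq0.
lra.
Qed.

Lemma lnln_near_ge (B : R) : \forall N \near \oo, B <= ln (ln N%:R) :> R.
Proof.
exists (Num.truncn (expR (expR B))).+1 => // N /= hN.
have h : expR (expR B) <= N%:R.
  by apply: le_trans (ltW (truncnS_gt _)) _; rewrite ler_nat.
have h1 : expR B <= ln N%:R.
  by rewrite -[leLHS]expRK ler_ln ?posrE ?expR_gt0// (lt_le_trans _ h) ?expR_gt0.
by rewrite -[leLHS]expRK ler_ln ?posrE ?expR_gt0// (lt_le_trans _ h1) ?expR_gt0.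
Qed.

(** For the least [j] with [16 ^ j] above the integer part of [Y], a prime in [(4 ^ j, 4 ^ (j + 3)]]
    has its square at most [16 ^ (j + 3)], which is [16^4] times [16 ^ (j - 1) <= Y]. *)
Lemma exists_prime_sqr (Y : R) : 1 <= Y ->
  exists2 q, prime q & Y <= q%:R ^+ 2 <= 16 ^+ 4 * Y.
Proof.
move=> Y1; have Y0 : 0 <= Y by lra.
have /andP[n1 n2] := truncn_itv Y0; set n := Num.truncn Y in n1 n2.
have n0 : (0 < n)%N by rewrite truncn_gt0.
pose j := up_log 16 n.+1.
have j0 : (0 < j)%N by rewrite up_log_gt0.
have hj1 : (n < 16 ^ j)%N by exact: up_logP.
have hj2 : (16 ^ j.-1 <= n)%N by rewrite -ltnS up_log_gtn.
have e16 i : (4 ^ i * 4 ^ i = 16 ^ i)%N by rewrite -expnMn.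
have [q pq /andP[q1 q2]] := prime_between j0.
exists q => //; apply/andP; split.
  apply: (@le_trans _ _ (16 ^ j)%:R); first by apply: le_trans (ltW n2) _; rewrite ler_nat.
  by rewrite -natrX ler_nat -e16 -mulnn leq_mul// ltnW.
apply: (@le_trans _ _ (16 ^+ 4 * (16 ^ j.-1)%:R)).
  rewrite -!natrX -natrM ler_nat -mulnn; apply: leq_trans (leq_mul q2 q2) _.
  by rewrite e16 -{1}(prednK j0) addSn -addnS expnD mulnC.
by rewrite ler_wpM2l ?exprn_ge0//; apply: le_trans n1; rewrite ler_nat.
Qed.

End LowerBound.

Theorem theorem1 (R : realType) (w : nat -> nat)
    (w_add : additive_arith w)
    (w_prime : forall q : nat, prime q -> w q = 1%N) :
  exists2 c : R, 0 < c &
    \forall N \near \oo, c * (N%:R / ln (ln N%:R)) <= (Xi w N)%:R.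
Proof.
have [D [e [D1 HD]]] := psum_power_saving R 4; have D0 : 0 <= D by lra.
have [a a_ge] : exists a : nat, (4 * 144 <= a)%N by exists (4 * 144)%N.
have aR : 4 * 144 <= a%:R :> R by rewrite -natrM ler_nat.
pose A : R := 8 * a%:R; have A1 : 1 <= A by rewrite /A; lra.
have A2 : 1 <= A ^+ 2 by rewrite exprn_ege1.
(* Chosen so that [q^2 >= K0 L], with [L = ln (ln N)], implies the smallness condition of Turan's
   inequality. [K1] includes the loss [16^4] in the choice of the prime, so that [q^2 <= K1 L]. *)
pose K0 : R := A ^+ 2 * 28 * (72 * 144); have K01 : 1 <= K0 by rewrite /K0; lra.
pose K1 : R := 16 ^+ 4 * K0; have K11 : 1 <= K1 by rewrite /K1 mulr_ege1// exprn_ege1//; lra.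
have [B1 H1] := @expR_ge_poly R D K1 e D0 ltac:(lra).
have [B2 H2] := @expR_ge_poly R 2 K1 3 ltac:(lra) ltac:(lra).
exists (4 * K1)^-1; first by rewrite invr_gt0; lra.
near=> N.
(* Needed for [3 (9 + 8 (2 + L)) + 1 = 76 + 24 L <= 28 L], the origin of the constant 28. *)
have L19 : 19 <= ln (ln N%:R) :> R by near: N; exact: lnln_near_ge.
have LB1 : B1 <= ln (ln N%:R) by near: N; exact: lnln_near_ge.
have LB2 : B2 <= ln (ln N%:R) by near: N; exact: lnln_near_ge.
(* Squared because [q] is only known to satisfy [q^2 >= L]; the same holds for [LA]. *)
have LD : (D * A ^+ 4) ^+ 2 <= ln (ln N%:R) by near: N; exact: lnln_near_ge.
have LA : A ^+ 2 <= ln (ln N%:R) by near: N; exact: lnln_near_ge.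
set L := ln (ln N%:R) in L19 LB1 LB2 LD LA *.
have lN0 : 0 < ln N%:R :> R.
  by rewrite ltNge; apply/negP => /ln0 h; move: L19; rewrite /L h; lra.
have eL : expR L = ln N%:R by rewrite /L lnK ?posrE.
have N0 : (0 : R) < N%:R.
  by rewrite ltNge; apply/negP => /ln0 h; move: lN0; rewrite h ltxx.
have hlN : ln N%:R <= N%:R :> R by exact/ltW/ln_sublinear.
have K0L : L <= K0 * L by rewrite ler_peMl//; lra.
have [q pq /andP[q1 q2]] := @exists_prime_sqr R (K0 * L) ltac:(lra).
have q0 : (1 : R) <= q%:R by rewrite ler1n prime_gt0.
have q_ge (Z : R) : 0 <= Z -> Z ^+ 2 <= L -> Z <= q%:R.
  move=> Z0 ZL; rewrite -ler_sqr ?nnegrE//; lra.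
have q2' : q%:R ^+ 2 <= K1 * L by rewrite /K1 -mulrA.
have q3 : q%:R <= K1 * L :> R by apply: le_trans q2'; rewrite expr2 ler_peMl//; lra.
have h : N%:R / (4 * q%:R ^+ 2) <= (Xi w N)%:R :> R.
  apply: (Xi_ge D0 HD w_add w_prime pq a_ge).
  - by rewrite -(ler_nat R) natrM -/A; apply: q_ge => //; lra.
  - rewrite -/A expr_div_n.
    have N0' : (0 < N)%N by rewrite -(ltr0n R).
    have hmu : 3 * recip_primes R N + 1 <= 28 * L.
      have h1 := recip_primes_le R N0'.
      have h2 : ln (1 + 2 * ln N%:R) <= 2 + L :> R.
        have l1 : 1 <= ln N%:R :> R by rewrite -eL; have := expR_ge1Dx L; lra.
        apply: (@le_trans _ _ (ln (3 * ln N%:R))).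
          by rewrite ler_ln ?posrE; lra.
        rewrite lnM ?posrE// -/L lerD2r.
        by have := @ln_subr1_le R 3 ltac:(lra); lra.
      lra.
    have q20 : (0 : R) < q%:R ^+ 2 by rewrite exprn_gt0//; lra.
    rewrite [A ^+ 2 / _ * _]mulrAC mulrA ler_pdivrMr// mul1r; apply: le_trans q1.
    rewrite (_ : K0 * L = 72 * 144 * (A ^+ 2 * (28 * L))); last by rewrite /K0; ring.
    by rewrite ler_pM2l//; apply: ler_wpM2l; lra.
  - by rewrite -/A; apply: q_ge => //; rewrite mulr_ge0// exprn_ge0//; lra.
  - rewrite -eL; apply: le_trans (H1 _ LB1).
    by rewrite ler_wpM2l// lerXn2r ?nnegrE//; lra.
  - apply: le_trans hlN; rewrite -eL; apply: le_trans (H2 _ LB2).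
    by rewrite ler_wpM2l// lerXn2r ?nnegrE//; lra.
apply: le_trans h.
rewrite mulrCA; apply: ler_wpM2l; first exact: ltW.
rewrite -invfM lef_pV2 ?posrE.
- by rewrite -mulrA ler_pM2l.
- by rewrite !mulr_gt0//; lra.
- by rewrite mulr_gt0// exprn_gt0//; lra.
Unshelve. all: end_near.
Qed.
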